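(* Let a random iterated function system with contraction factors $a_1,\dots,a_K$ be given as in the context (independent probabilities case), and set $\overline a_j=\operatorname{ess\,sup}a_j$ and $\underline a_j=\operatorname{ess\,inf}a_j$ for $j=1,\dots,K$. (i) Let $\Delta\ge0$ be defined by $\sum_{j=1}^K\overline a_j^{\,\Delta}=1$. Whenever the probabilities are chosen independently from the scaling factors, almost surely $\overline{\dim}_\Phi\,\mu_{\boldsymbol\omega}\ge\Delta$ for all small dimension functions $\Phi$. Furthermore, given any $R\in[\Delta,\infty)$, there is a choice of independent probabilities such that almost surely $\overline{\dim}_\Phi\,\mu_{\boldsymbol\omega}=R$ for all small dimension functions $\Phi$. (ii) Let $\delta$ satisfy $\sum_{j=1}^K\underline a_j^{\,\delta}=1$. Whenever the probabilities are chosen independently from the scaling factors, almost surely $\underline{\dim}_\Phi\,\mu_{\boldsymbol\omega}\le\delta$ for all small dimension functions $\Phi$. Furthermore, for every $r\in(0,\delta]$ there is a choice of independent probabilities such that almost surely $\underline{\dim}_\Phi\,\mu_{\boldsymbol\omega}=r$ for all small dimension functions $\Phi$.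
   Context: **Dimension functions.** A dimension function is a map $\Phi:(0,1)\to[0,\infty)$ such that $t^{1+\Phi(t)}$ decreases to $0$ as $t$ decreases to $0$. It is called small if (for $t$ near $0$) $\Phi(t)=H(t)\,\frac{\log|\log t|}{|\log t|}$ with $H(t)\to0$ as $t\to0$. **$\Phi$-dimensions of measures.** Let $X$ be a bounded metric space (here $X=[0,1]$) and $B(x,R)$ the open ball with centre $x$ and radius $R$. The upper $\Phi$-dimension $\overline{\dim}_\Phi\mu$ of a measure $\mu$ on $X$ is the infimum of all $d$ for which there are $C_1,C_2>0$ such that for all $0<r<R^{1+\Phi(R)}\le R\le C_1$ and all $x\in\operatorname{supp}\mu$, $\frac{\mu(B(x,R))}{\mu(B(x,r))}\le C_2(R/r)^d$ (with $\inf\emptyset=\infty$); the lower $\Phi$-dimension $\underline{\dim}_\Phi\mu$ is the supremum of all $d$ for which there are $C_1,C_2>0$ such that for all such $r,R,x$, $\frac{\mu(B(x,R))}{\mu(B(x,r))}\ge C_2(R/r)^d$. **Random iterated function system.** Let $(\Omega_0,P)$ be a probability space, $K\ge2$ an integer, and $A,B,\tau>0$ constants with $0<KA\le B<1$ and $\tau\le(1-B)/K$. For each $\omega\in\Omega_0$, $\mathcal I_\omega=\{S_1(\omega),\dots,S_K(\omega)\}$ is an iterated function system of $K$ similarities mapping $[0,1]$ into itself; $S_j(\omega)$ has contraction factor (scaling factor) $a_j(\omega)$ (a random variable), with $A\le a_j(\omega)\le\sum_{i=1}^K a_i(\omega)\le B$ for all $j,\omega$, and the distance between $S_i(\omega)[0,1]$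 and $S_j(\omega)[0,1]$ is at least $\tau$ for all $i\ne j$ and all $\omega$. **Independent probabilities case.** Probability weights $\mathcal P_\omega=\{p_1(\omega),\dots,p_K(\omega)\}$ are random variables with $p_i(\omega)\ge0$ and $\sum_i p_i(\omega)=1$ for every $\omega$, such that for some $t>0$, $\mathbb E_\omega(p_i(\omega)^{-t})<\infty$ for each $i$. In the independent probabilities case, $\Omega_0=\Gamma_1\times\Gamma_2$ is a product of probability spaces with the product measure, and, writing $\omega=(u,v)$ with $u\in\Gamma_1$, $v\in\Gamma_2$, $\mathcal I_\omega$ depends only on $u$ and $\mathcal P_\omega$ depends only on $v$ (so the contraction factors and the probabilities are independent of each other). The family of iterated function systems (indexed by $u\in\Gamma_1$) is regarded as fixed, and ''a choice of independent probabilities'' means a choice of $\Gamma_2$ and of weights $p_1,\dots,p_K$ depending only on $v\in\Gamma_2$ as just described (constant weights are allowed). **Random measure.** Let $\Omega=\Omega_0^{\mathbb N}$ with the infinite product measure $\mathbb P$. For $\boldsymbol\omega=(\boldsymbol\omega_1,\boldsymbol\omega_2,\dots)\in\Omega$ put $I_{i_1,\dots,i_n}(\boldsymbol\omega)=S_{i_1}(\boldsymbol\omega_1)\circ\cdots\circ S_{i_n}(\boldsymbol\omega_n)[0,1]$. $\mu_{\boldsymbol\omega}$ is the Borel probability measure with $\mu_{\boldsymbol\omega}([0,1])=1$ and $\mu_{\boldsymbol\omega}(I_{i_1,\dots,i_n}(\boldsymbol\omega))=p_{i_1}(\boldsymbol\omega_1)\cdots p_{i_n}(\boldsymbol\omega_n)$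 for all $n$ and $i_1,\dots,i_n\in\{1,\dots,K\}$. ''Almost surely'' refers to $\mathbb P$; essential suprema/infima are over $\Omega_0$ with respect to $P$. *)

(* Defs.v *)
From HB Require Import structures.
From mathcomp Require Import all_boot all_order all_algebra.
From mathcomp Require Import all_classical all_reals all_analysis.
Set Implicit Arguments.
Unset Strict Implicit.
Unset Printing Implicit Defensive.
Import Order.TTheory GRing.Theory Num.Theory.
Import numFieldNormedType.Exports.
Local Open Scope classical_set_scope.
Local Open Scope ring_scope.

Section DimensionFunctions.
Context {R : realType}.

(* Only the values on ]0, 1[ are relevant. *)
Definition dimension_function (Phi : R -> R) : Prop :=
  [/\ forall t : R, 0 < t < 1 -> 0 <= Phi t,
      forall s t : R, 0 < s -> s <= t -> t < 1 ->
        s `^ (1 + Phi s) <= t `^ (1 + Phi t)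
    & t `^ (1 + Phi t) @[t --> 0^'+] --> 0].

Definition small_dimension_function (Phi : R -> R) : Prop :=
  dimension_function Phi /\
  exists H : R -> R,
    (\forall t \near 0^'+, Phi t = H t * (ln `|ln t| / `|ln t|)) /\
    H t @[t --> 0^'+] --> 0.

End DimensionFunctions.

Section PhiDimensions.
Context {R : realType}.
Implicit Types (Phi : R -> R) (mu : set R -> \bar R).

(* Open balls of the metric space X = [0, 1]; a measure on X is represented by
   a Borel measure on R that gives [0, 1] full mass. *)
Definition ball01 (x r : R) : set R := `[0, 1] `&` ball x r.

Definition supp01 mu : set R :=
  [set x | x \in `[0, 1] /\ forall r, 0 < r -> (0 < mu (ball01 x r))%E].

(* Shrinking C1 only weakens the condition, so one may always take C1 < 1 and
   the values of Phi outside ]0, 1[ play no role.  The measures considered are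
   finite, so that [fine] loses nothing. *)
Definition upper_Phi_dim Phi mu : \bar R :=
  ereal_inf [set d%:E | d in [set d : R |
    exists C1 C2 : R, [/\ 0 < C1, 0 < C2 &
      forall r rho x : R,
        0 < r -> r < rho `^ (1 + Phi rho) -> rho `^ (1 + Phi rho) <= rho ->
        rho <= C1 -> supp01 mu x ->
        fine (mu (ball01 x rho)) / fine (mu (ball01 x r))
          <= C2 * (rho / r) `^ d]]].

Definition lower_Phi_dim Phi mu : \bar R :=
  ereal_sup [set d%:E | d in [set d : R |
    exists C1 C2 : R, [/\ 0 < C1, 0 < C2 &
      forall r rho x : R,
        0 < r -> r < rho `^ (1 + Phi rho) -> rho `^ (1 + Phi rho) <= rho ->
        rho <= C1 -> supp01 mu x ->
        fine (mu (ball01 x rho)) / fine (mu (ball01 x r))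
          >= C2 * (rho / r) `^ d]]].

End PhiDimensions.

Section RandomIFS.
Context {R : realType}.

(* S j u is used only as a map of [0, 1] into itself. *)
Record random_ifs d (U : measurableType d) (K : nat) (A B tau : R)
    (S : 'I_K -> U -> R -> R) (a : 'I_K -> U -> R) : Prop := {
  ifs_K_ge2 : (2 <= K)%N ;
  ifs_A_gt0 : 0 < A ;
  ifs_tau_gt0 : 0 < tau ;
  ifs_KA_le_B : K%:R * A <= B ;
  ifs_B_lt1 : B < 1 ;
  ifs_tau_le : tau <= (1 - B) / K%:R ;
  ifs_maps01 : forall j u x, x \in `[0, 1] -> S j u x \in `[0, 1] ;
  ifs_similarity : forall j u x y, x \in `[0, 1] -> y \in `[0, 1] ->
    `|S j u x - S j u y| = a j u * `|x - y| ;
  ifs_factor_measurable : forall j, measurable_fun [set: U] (a j) ;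
  ifs_factor_ge : forall j u, A <= a j u ;
  ifs_factor_sum : forall u, \sum_(i < K) a i u <= B ;
  ifs_separation : forall i j u x y, i != j ->
    x \in `[0, 1] -> y \in `[0, 1] -> tau <= `|S i u x - S j u y|
}.

(* q ^ (- t) for q >= 0 and t > 0, equal to +oo at q = 0, whereas the
   library's real power 0 `^ (- t) is 0. *)
Definition neg_power (q t : R) : \bar R :=
  if q == 0 then +oo%E else (q `^ (- t))%:E.

Record random_weights d (V : measurableType d) (Q : probability V R) (K : nat)
    (p : 'I_K -> V -> R) : Prop := {
  weights_measurable : forall j, measurable_fun [set: V] (p j) ;
  weights_ge0 : forall j v, 0 <= p j v ;
  weights_sum1 : forall v, \sum_(j < K) p j v = 1 ;
  weights_moment : exists t : R, 0 < t /\
    forall j, (\int[Q]_v neg_power (p j v) t < +oo)%E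
}.

End RandomIFS.

Section InfiniteProduct.
Context d (T : measurableType d).

Definition coordinate_sets : set (set (nat -> T)) :=
  [set E | exists (n : nat) (A : set T),
     measurable A /\ E = [set w : nat -> T | A (w n)]].

(* T^nat with the product sigma-algebra *)
Definition sequence_space := g_sigma_algebraType coordinate_sets.

(* PP is the infinite power of P; this determines PP uniquely. *)
Definition is_infinite_power (R : realType) (P : set T -> \bar R)
    (PP : probability sequence_space R) : Prop :=
  forall (n : nat) (A : 'I_n -> set T), (forall i, measurable (A i)) ->
    PP [set w : nat -> T | forall i : 'I_n, A i (w i)] = (\prod_(i < n) P (A i))%E.

End InfiniteProduct.

Section RandomMeasure.
Context {R : realType}.

(* S_{i_1}(w_1) o ... o S_{i_n}(w_n) [0, 1], the sequence w being indexed
   from 0 *)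
Definition cylinder (T : Type) (K : nat) (S : 'I_K -> T -> R -> R)
    (w : nat -> T) (n : nat) (i : n.-tuple 'I_K) : set R :=
  (\big[@comp R R R/id]_(k < n) S (tnth i k) (w k)) @` `[0, 1].

(* These conditions determine mu. *)
Definition is_random_measure (T : Type) (K : nat) (S : 'I_K -> T -> R -> R)
    (p : 'I_K -> T -> R) (w : nat -> T)
    (mu : probability (measurableTypeR R) R) : Prop :=
  mu `[0%R, 1%R]%classic = 1%E /\
  forall (n : nat) (i : n.-tuple 'I_K),
    mu (cylinder S w i) = (\prod_(k < n) p (tnth i k) (w k))%:E.

(* In the independent probabilities case (Omega_0 = U * V with the product
   probability, the maps depending on the first component and the weights on
   the second one), the random measure almost surely satisfies E.  The
   exceptional set is required to be contained in a measurable null set. *)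
Definition almost_surely d1 d2 (U : measurableType d1) (V : measurableType d2)
    (P : probability U R) (Q : probability V R) (K : nat)
    (S : 'I_K -> U -> R -> R) (p : 'I_K -> V -> R)
    (E : (set R -> \bar R) -> Prop) : Prop :=
  forall PP : probability (sequence_space (U * V)%type) R,
    is_infinite_power (P \x Q)%E PP ->
  forall mu : (nat -> U * V) -> probability (measurableTypeR R) R,
    (forall w, is_random_measure (fun j z => S j z.1) (fun j z => p j z.2)
                 w (mu w)) ->
  {ae PP, forall w, E (mu w)}.

End RandomMeasure.

(* Main.v *)
Require Import Defs.
From HB Require Import structures.
From mathcomp Require Import all_boot all_order all_algebra.
From mathcomp Require Import all_classical all_reals all_analysis ess_sup_inf.
From mathcomp Require Import measurable_realfun lra ring zify.
Set Implicit Arguments.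
Unset Strict Implicit.
Unset Printing Implicit Defensive.
Import Order.TTheory GRing.Theory Num.Theory.
Import numFieldNormedType.Exports.
Local Open Scope classical_set_scope.
Local Open Scope ring_scope.

(** Balls and cylinders. The separation condition makes balls comparable to
    cylinders: a ball of radius at most [tau] times the length of the parent of
    a cylinder, centred in that cylinder, carries no mass outside it
    ([ball_mass_le]), and a ball contains every shorter cylinder through its
    centre ([ball_mass_ge]). So ratios of ball masses are, up to constants,
    products of weights [p] over a window of letters, to be compared with the
    corresponding products of factors [a].

    Bounds at every scale. If [p j >= a j ^ D] always, multiplying over the
    window shows that [D] is an admissible exponent for the upper dimension; if
    [p j <= a j ^ D] always, for the lower one ([upper_exponent_uniform],
    [lower_exponent_uniform]).

    Bounds from rare windows. For a small [Phi], the condition relating the two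
    radii only asks that a window starting at level [n] be longer than a constant
    times [H * log n], where [H] tends to 0. In an independent sequence, an event of positive probability almost surely occurs along
    [m] consecutive steps at levels that are only exponential in [m], for
    infinitely many [m] ([long_runs]), and such runs are long enough
    ([small_window]). If the event says that one fixed letter [j] has
    [p j <= theta * a j ^ d] with [theta < 1], then the point of constant address
    [j] violates the exponent [d] ([low_mass_run_upper]); dually for the lower
    dimension ([high_mass_run_lower]).

    Role of independence. Write [asup j] and [ainf j] for the essential supremum
    and infimum of [a j]. The weights sum to 1, as do the powers
    [asup j ^ Delta], so [p j <= asup j ^ Delta] with positive probability for
    some [j]. As [a j] comes close to [asup j] with positive probability and
    independently of [p j], the event required above has positive probability
    for every [d < Delta] ([upper_dim_ge_ae]). A single
    letter is involved, so each essential supremum is approached separately. The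
    bound for the lower dimension is obtained in the same way from [ainf]
    ([lower_dim_le_ae]).

    Sharpness. For [D >= Delta] there are constant weights [c] with
    [c j >= asup j ^ D] for all [j] and equality for one [j]
    ([weights_above_powers]). The inequalities bound the upper dimension by [D],
    and the equality makes [D] a lower bound by the run argument. Constant
    weights with [c j <= ainf j ^ r], again with one equality, realize the lower dimension [r]
    ([weights_below_powers]). *)

(** * Powers *)

Section Powers.
Context {R : realType}.

Lemma expr_lt_eventually (theta e : R) : 0 < theta -> theta < 1 -> 0 < e ->
  exists N, forall m, (N <= m)%N -> theta ^+ m < e.
Proof.
move=> t0 t1 e0; have B1' : `|theta| < 1 by rewrite gtr0_norm.
have /cvgrPdist_lt/(_ _ e0)[N _ hN] := cvg_expr B1'.
exists N => m /hN; by rewrite /= sub0r normrN normrX gtr0_norm.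
Qed.

Lemma powR_lt_exp (x r s : R) : 0 < x < 1 -> r < s -> x `^ s < x `^ r.
Proof.
move=> /andP[x0 x1] rs; rewrite /powR gt_eqF// ltr_expR.
by rewrite ltr_nM2r// ln_lt0// x0.
Qed.

(** Bernoulli's inequality for [(1 + x) ^ n], combined with [(1 - x) * (1 + x) <= 1]. *)
Lemma expr_1B_le (x : R) n : 0 <= x -> x <= 1 -> (1 - x) ^+ n <= (1 + n%:R * x)^-1.
Proof.
move=> x0 x1; rewrite -div1r ler_pdivlMr ?ltr_pwDl// ?mulr_ge0//.
apply: (@le_trans _ _ ((1 - x) ^+ n * (1 + x) ^+ n)).
  rewrite ler_wpM2l ?exprn_ge0 ?subr_ge0//; elim: n => [|n ih]; first by rewrite mul0r addr0 expr0.
  rewrite exprS; apply: (@le_trans _ _ ((1 + x) * (1 + n%:R * x))); last first.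
    by rewrite ler_pM2l// ltr_pwDl.
  have := ler0n R n; rewrite -natr1; nra.
by rewrite -exprMn exprn_ile1//; nra.
Qed.

End Powers.

(** * Cylinders *)

(** With composition as a monoid law, [big_ord_recr] splits off the innermost map
    of a branch. *)
HB.instance Definition _ (T : Type) := Monoid.isLaw.Build (T -> T) id (@comp T T T)
  (fun f g h => erefl) (fun f => erefl) (fun f => erefl).

Section Cylinders.
Context {R : realType} d (U : measurableType d) (K : nat) (A B tau : R)
  (S : 'I_K -> U -> R -> R) (a : 'I_K -> U -> R)
  (hIFS : random_ifs A B tau S a) (u : nat -> U).
Implicit Types (c e : nat -> 'I_K) (n k : nat) (x y r : R).

(** Addresses are infinite sequences of letters, read up to the level at hand:
    prefixes and extensions of a word then need no dependent types. *)
Definition branch c n : R -> R := \big[@comp R R R/id]_(k < n) S (c k) (u k).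
Definition cyl c n : set R := branch c n @` `[0, 1].
Definition len c n : R := \prod_(k < n) a (c k) (u k).

Lemma branchS c n x : branch c n.+1 x = branch c n (S (c n) (u n) x).
Proof. by rewrite /branch big_ord_recr. Qed.

Lemma factor_gt0 j v : 0 < a j v.
Proof. exact: lt_le_trans (ifs_A_gt0 hIFS) (ifs_factor_ge hIFS j v). Qed.

Lemma factor_le j v : a j v <= B.
Proof.
apply: le_trans (ifs_factor_sum hIFS v); rewrite (bigD1 j)//= lerDl.
by apply: sumr_ge0 => i _; exact: ltW (factor_gt0 i v).
Qed.

Lemma B_gt0 : 0 < B.
Proof.
apply: lt_le_trans (ifs_KA_le_B hIFS); rewrite mulr_gt0 ?(ifs_A_gt0 hIFS)//.
by rewrite ltr0n; exact: leq_trans (ifs_K_ge2 hIFS).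
Qed.

Lemma A_lt1 : A < 1.
Proof.
apply: le_lt_trans (ifs_B_lt1 hIFS); apply: le_trans (ifs_KA_le_B hIFS).
rewrite ler_peMl ?(ltW (ifs_A_gt0 hIFS))// ler1n.
exact: leq_trans (ifs_K_ge2 hIFS).
Qed.

Lemma tau_lt1 : tau < 1.
Proof.
apply: le_lt_trans (ifs_tau_le hIFS) _; have K2 := ifs_K_ge2 hIFS.
rewrite ltr_pdivrMr ?ltr0n ?(leq_trans _ K2)// mul1r.
apply: (@lt_le_trans _ _ 1); first by have := B_gt0; lra.
by rewrite ler1n (leq_trans _ K2).
Qed.

Lemma expB_lt r : 0 < r -> exists n, B ^+ n < r.
Proof.
move=> r0.
have [N hN] := expr_lt_eventually B_gt0 (ifs_B_lt1 hIFS) r0.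
by exists N; exact: hN.
Qed.

Lemma lenS c n : len c n.+1 = len c n * a (c n) (u n).
Proof. by rewrite /len big_ord_recr. Qed.

Lemma len0 c : len c 0 = 1.
Proof. by rewrite /len big_ord0. Qed.

Lemma len_gt0 c n : 0 < len c n.
Proof. by apply: prodr_gt0 => k _; exact: factor_gt0. Qed.

Lemma len_geA c n : A * len c n <= len c n.+1.
Proof.
by rewrite lenS mulrC ler_wpM2l ?(ltW (len_gt0 _ _))// (ifs_factor_ge hIFS).
Qed.

Lemma len_decr c n : len c n.+1 <= len c n.
Proof.
rewrite lenS ger_pMr ?len_gt0// (le_trans (factor_le _ _))//.
exact: ltW (ifs_B_lt1 hIFS).
Qed.

Lemma len_noninc c k n : (k <= n)%N -> len c n <= len c k.
Proof.
move=> /subnKC <-; elim: (n - k)%N => [|i ih]; first by rewrite addn0.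
by rewrite addnS (le_trans (len_decr _ _)).
Qed.

Lemma len_add_le c n m : len c (n + m) <= len c n * B ^+ m.
Proof.
elim: m => [|m ih]; first by rewrite addn0 expr0 mulr1.
rewrite addnS lenS exprSr mulrA.
apply: ler_pM => //; [exact: ltW (len_gt0 _ _)|exact: ltW (factor_gt0 _ _)|].
exact: factor_le.
Qed.

Lemma len_le c n : len c n <= B ^+ n.
Proof. by have := len_add_le c 0 n; rewrite add0n len0 mul1r. Qed.

Lemma len_ge c n : A ^+ n <= len c n.
Proof.
elim: n => [|n ih]; first by rewrite len0.
by rewrite exprS (le_trans _ (len_geA _ _))// ler_wpM2l// ltW// (ifs_A_gt0 hIFS).
Qed.

Lemma branch_itv c n x : x \in `[0, 1] -> branch c n x \in `[0, 1].
Proof.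
elim: n x => [|n ih] x x01; first by rewrite /branch big_ord0.
by rewrite branchS ih// (ifs_maps01 hIFS).
Qed.

Lemma branch_dist c n x y : x \in `[0, 1] -> y \in `[0, 1] ->
  `|branch c n x - branch c n y| = len c n * `|x - y|.
Proof.
elim: n x y => [|n ih] x y x01 y01; first by rewrite /branch big_ord0 len0 mul1r.
rewrite !branchS ih ?(ifs_maps01 hIFS)// lenS (ifs_similarity hIFS)//.
by rewrite mulrA.
Qed.

Lemma cyl0 c : cyl c 0 = `[0, 1]%classic.
Proof. by rewrite /cyl /branch big_ord0 image_id. Qed.

Lemma cyl_itv c n : cyl c n `<=` `[0, 1].
Proof. by move=> _ [x /= x01 <-]; rewrite branch_itv. Qed.

Lemma cylS_sub c n : cyl c n.+1 `<=` cyl c n.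
Proof.
move=> _ [x /= x01 <-]; rewrite branchS; exists (S (c n) (u n) x) => //=.
by rewrite (ifs_maps01 hIFS).
Qed.

Lemma cyl_sub c k n : (k <= n)%N -> cyl c n `<=` cyl c k.
Proof.
move=> /subnKC <-; elim: (n - k)%N => [|i ih]; first by rewrite addn0.
by rewrite addnS; apply: subset_trans ih; exact: cylS_sub.
Qed.

Lemma cyl_diam c n x y : cyl c n x -> cyl c n y -> `|x - y| <= len c n.
Proof.
move=> [x' /= x01 <-] [y' /= y01 <-]; rewrite branch_dist//.
rewrite ger_pMr ?len_gt0//; move: x01 y01; rewrite !in_itv/= ler_norml; lra.
Qed.

(** Only the first [n] letters of [c] matter to its cylinder of level [n], so
    the children of that cylinder are obtained by changing the letter of index
    [n]; this avoids casts between words of different lengths. *)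
Definition upd c n j : nat -> 'I_K := fun k => if k == n then j else c k.

Lemma branch_upd c n j : branch (upd c n j) n = branch c n.
Proof. by apply: eq_bigr => k _; rewrite /upd ltn_eqF. Qed.

Lemma cyl_upd_sub c n j : cyl (upd c n j) n.+1 `<=` cyl c n.
Proof.
by apply: subset_trans (@cylS_sub _ _) _; rewrite /cyl branch_upd.
Qed.

Lemma upd_id c n : upd c n (c n) = c.
Proof. by apply/funext => k; rewrite /upd; case: eqP => // ->. Qed.

(** Two siblings are images of the [S i (u n)] and [S j (u n)] pieces under
    their common parent branch, a similarity of ratio [len c n]. *)
Lemma cyl_separation c n i j x y : i != j ->
  cyl (upd c n i) n.+1 x -> cyl (upd c n j) n.+1 y ->
  tau * len c n <= `|x - y|.
Proof.
move=> ij [x' /= x01 <-] [y' /= y01 <-].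
rewrite !branchS !branch_upd branch_dist ?(ifs_maps01 hIFS)//.
rewrite mulrC ler_wpM2l ?(ltW (len_gt0 _ _))// /upd eqxx.
exact: (ifs_separation hIFS).
Qed.

Lemma cyl_compact c n : compact (cyl c n).
Proof.
apply: continuous_compact; last exact: segment_compact.
apply/subspace_continuousP => x x01; apply/cvgrPdist_lt => e e0.
have := @nbhsx_ballx R R x e e0; apply: filterS => y /= xye y01.
rewrite branch_dist//; apply: le_lt_trans xye.
by rewrite ler_piMl// (le_trans (len_le _ _))// exprn_ile1 ?ltW ?B_gt0 ?(ifs_B_lt1 hIFS).
Qed.

Lemma cyl_closed c n : closed (cyl c n).
Proof. by apply: compact_closed (@cyl_compact c n); exact: Rhausdorff. Qed.

Lemma cyl_measurable c n : measurable (cyl c n : set (measurableTypeR R)).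
Proof.
exact: compact_measurable (@cyl_compact c n).
Qed.

(** The orbit of 0 along [c] lies in the compact interval, so it clusters; each
    cylinder is closed and contains a tail of the orbit. *)
Lemma cyl_bigcap_neq0 c : exists x, forall n, cyl c n x.
Proof.
have h01 n : `[0, 1]%classic (branch c n 0).
  by apply: (@cyl_itv c n); exists 0 => //=; rewrite in_itv/= lexx ler01.
have [|x [_]] := @segment_compact R 0 1 (branch c n 0 @[n --> \oo]) _.
  by exists 0%N => // n _; exact: h01.
move=> xcl; exists x => n.
apply: cyl_closed => V xV; apply: xcl => //.
exists n => // m /= nm; apply: (cyl_sub nm).
by exists 0 => //=; rewrite in_itv/= lexx ler01.
Qed.
End Cylinders.

(** * Masses of cylinders and balls *)

Section Masses.
Context {R : realType} d (U : measurableType d) (K : nat) (A B tau : R)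
  (S : 'I_K -> U -> R -> R) (a : 'I_K -> U -> R)
  (hIFS : random_ifs A B tau S a) (u : nat -> U).
Context (q : nat -> 'I_K -> R) (mu : probability (measurableTypeR R) R).
Implicit Types (c e : nat -> 'I_K) (n k : nat) (x y r : R).

Definition mass c n : R := \prod_(k < n) q k (c k).

Context (q_sum1 : forall k, \sum_(j < K) q k j = 1)
  (mu_cyl : forall c n, mu (cyl S u c n) = (mass c n)%:E).

Notation cyl := (cyl S u).
Notation len := (len a u).

Lemma massS c n : mass c n.+1 = mass c n * q n (c n).
Proof. by rewrite /mass big_ord_recr. Qed.

Lemma mass_upd c n j : mass (upd c n j) n.+1 = mass c n * q n j.
Proof.
rewrite massS {2}/upd eqxx; congr (_ * _).
by apply: eq_bigr => k _; rewrite /upd ltn_eqF.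
Qed.

Lemma mass_gt0 c n : (forall k, (k < n)%N -> 0 < q k (c k)) -> 0 < mass c n.
Proof. by move=> h; apply: prodr_gt0 => k _; exact: h. Qed.

Lemma child_disjoint c n :
  trivIset setT (fun j => cyl (upd c n j) n.+1).
Proof.
apply/trivIsetP => i j _ _ ij; apply/seteqP; split=> // x [xi xj].
have := cyl_separation hIFS ij xi xj; rewrite subrr normr0.
by rewrite leNgt mulr_gt0 ?(ifs_tau_gt0 hIFS)// (len_gt0 hIFS).
Qed.

Definition children c n : set R := \big[setU/set0]_(j < K) cyl (upd c n j) n.+1.

Lemma childrenP c n x : children c n x <-> exists j, cyl (upd c n j) n.+1 x.
Proof.
rewrite /children -bigcup_seq; split=> [[j _ xj]|[j xj]]; exists j => //=.
by rewrite mem_index_enum.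
Qed.

Lemma children_measurable c n : measurable (children c n : set (measurableTypeR R)).
Proof. by apply: bigsetU_measurable => j _; exact: (cyl_measurable hIFS). Qed.

(** The weights of one step sum to 1, so the children carry the whole mass of
    their parent and the gaps between them are null. *)
Lemma cyl_children_null c n : mu.-negligible (cyl c n `\` children c n).
Proof.
have mc := cyl_measurable hIFS u c n; have mh := children_measurable c n.
apply/(negligibleP _ (measurableD mc mh)).
rewrite measureD//; last by apply: le_lt_trans (probability_le1 mu mc) _; rewrite ltry.
rewrite (_ : cyl c n `&` _ = children c n); last first.
  apply/seteqP; split=> x; first by case.
  move=> xh; split => //; move/childrenP : xh => [j]; exact: (cyl_upd_sub hIFS).
rewrite [X in (X - _)%E](mu_cyl c n) /children measure_bigsetU_ord//; [|by move=> j; exact: (cyl_measurable hIFS)|exact: child_disjoint].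
rewrite (eq_bigr (fun j => (mass c n * q n j)%:E)); last first.
  by move=> j _; rewrite -mass_upd; exact: mu_cyl.
by rewrite sumEFin -mulr_sumr q_sum1 mulr1 subee.
Qed.

Lemma ball01_measurable x r : measurable (ball01 x r : set (measurableTypeR R)).
Proof.
apply: measurableI; first exact: measurable_itv.
by rewrite ball_itv; exact: measurable_itv.
Qed.

(** A point of the ball outside [cyl c n] leaves the cylinders along [c] at some
    level; it falls there into a gap, which is null, because the siblings are too
    far from [x]. *)
Lemma ball_cyl_null c n x r : cyl c n x ->
  (forall k, (k < n)%N -> r <= tau * len c k) ->
  mu.-negligible (ball01 x r `\` cyl c n).
Proof.
elim: n => [|n ih] xn hr.
  rewrite cyl0; apply: negligibleS (@negligible_set0 _ _ _ mu).
  by move=> y [[]].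
have hn := ih (cylS_sub hIFS xn) (fun k kn => hr k (ltnW kn)).
apply: negligibleS (negligibleU hn (cyl_children_null c n)).
move=> y [[y01 /= xy] yn]; have [yc|yc] := pselect (cyl c n y); last first.
  by left; split=> //; split.
right; split=> // /childrenP[j yj].
have jc : c n != j.
  by apply/eqP => jc; apply: yn; rewrite -(upd_id c n) jc.
have xc : cyl (upd c n (c n)) n.+1 x by rewrite upd_id.
have := cyl_separation hIFS jc xc yj; have := hr n (ltnSn n).
by move: xy; rewrite /ball/=; lra.
Qed.

Lemma ball_mass_le c n x r : cyl c n x ->
  (forall k, (k < n)%N -> r <= tau * len c k) ->
  fine (mu (ball01 x r)) <= mass c n.
Proof.
move=> xn hr; have mb := ball01_measurable x r.
rewrite -lee_fin fineK ?fin_num_measure//; have mc := cyl_measurable hIFS u c n.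
rewrite (measureDI mu mb mc) (measure_negligible _ (ball_cyl_null xn hr)).
  rewrite add0e -mu_cyl; apply: le_measure; rewrite ?inE//; exact: measurableI.
exact: measurableD.
Qed.

Lemma ball_mass_ge c n x r : cyl c n x -> len c n < r ->
  mass c n <= fine (mu (ball01 x r)).
Proof.
move=> xn hr; have mb := ball01_measurable x r.
rewrite -lee_fin fineK ?fin_num_measure// -mu_cyl.
apply: le_measure; rewrite ?inE//; first exact: (cyl_measurable hIFS).
move=> y yn; split; first exact: (cyl_itv hIFS yn).
exact: le_lt_trans (cyl_diam hIFS xn yn) hr.
Qed.

Lemma ball_mono x r s : r <= s ->
  fine (mu (ball01 x r)) <= fine (mu (ball01 x s)).
Proof.
move=> rs; have mb := ball01_measurable x.
apply: fine_le; rewrite ?fin_num_measure//.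
by apply: le_measure; rewrite ?inE//; apply: setIS; exact: le_ball.
Qed.

Lemma supp_ball_gt0 x r : supp01 mu x -> 0 < r -> 0 < fine (mu (ball01 x r)).
Proof.
move=> [_ h] r0; apply: fine_gt0; rewrite h//=.
by rewrite ltey_eq fin_num_measure//; exact: ball01_measurable.
Qed.

(** If a point [x] of [cyl c n] avoided all its children, a ball around [x] would lie,
    up to a null set, in the gaps of [cyl c n], and would be null. *)
Lemma supp_cyl x n : supp01 mu x -> exists c, cyl c n x.
Proof.
move=> [x01 xs]; elim: n => [|n [c xc]].
  have K0 : (0 < K)%N by apply: leq_trans (ifs_K_ge2 hIFS).
  by exists (fun=> Ordinal K0); rewrite cyl0.
have [[j xj]|nj] := pselect (exists j, cyl (upd c n j) n.+1 x).
  by exists (upd c n j).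
have cl : closed (children c n).
  by apply: closed_bigsetU => j _; exact: (cyl_closed hIFS).
have : nbhs x (~` children c n).
  apply: open_nbhs_nbhs; split; first exact: closed_openC.
  by move=> /childrenP.
move=> /nbhs_ballP[e /= e0 he].
have tl k : (k <= n)%N -> tau * len c n <= tau * len c k.
  by move=> kn; rewrite ler_pM2l ?(ifs_tau_gt0 hIFS)// (len_noninc hIFS).
pose r := Num.min e (tau * len c n).
have r0 : 0 < r by rewrite lt_min e0 mulr_gt0 ?(ifs_tau_gt0 hIFS) ?(len_gt0 hIFS).
have rn k : (k < n)%N -> r <= tau * len c k.
  by move=> kn; rewrite ge_min (tl _ (ltnW kn)) orbT.
have := xs _ r0; rewrite (@measure_negligible _ _ _ mu) ?ltxx//.
  exact: ball01_measurable.
apply: negligibleS (negligibleU (ball_cyl_null xc rn) (cyl_children_null c n)).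
move=> y [y01 xy]; have [yc|yc] := pselect (cyl c n y); last by left; split.
by right; split=> //; apply: he; apply: le_ball xy; rewrite ge_min lexx.
Qed.

Lemma supp_of_cyl c x : (forall k, 0 < q k (c k)) -> (forall n, cyl c n x) ->
  supp01 mu x.
Proof.
move=> qc xc; split; first by have := cyl_itv hIFS (xc 0%N).
move=> r r0; have [n hn] := expB_lt hIFS r0.
have mb := ball01_measurable x r.
rewrite -[ltRHS]fineK ?fin_num_measure// lte_fin.
apply: lt_le_trans (ball_mass_ge (xc n) _); first exact: mass_gt0.
exact: le_lt_trans (len_le hIFS _ _ _) hn.
Qed.

End Masses.

(** * Exponents of a measure *)

Section Exponents.
Context {R : realType}.
Implicit Types (Phi : R -> R) (mu : set R -> \bar R) (d D : R).

(** [upper_Phi_dim] and [lower_Phi_dim] are by definition the infimum and the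
    supremum of the two sets of exponents below; naming the sets lets one argue
    on single exponents. *)
Definition upper_exponent Phi mu d : Prop :=
  exists C1 C2 : R, [/\ 0 < C1, 0 < C2 &
    forall r rho x : R,
      0 < r -> r < rho `^ (1 + Phi rho) -> rho `^ (1 + Phi rho) <= rho ->
      rho <= C1 -> supp01 mu x ->
      fine (mu (ball01 x rho)) / fine (mu (ball01 x r)) <= C2 * (rho / r) `^ d].

Definition lower_exponent Phi mu d : Prop :=
  exists C1 C2 : R, [/\ 0 < C1, 0 < C2 &
    forall r rho x : R,
      0 < r -> r < rho `^ (1 + Phi rho) -> rho `^ (1 + Phi rho) <= rho ->
      rho <= C1 -> supp01 mu x ->
      C2 * (rho / r) `^ d <= fine (mu (ball01 x rho)) / fine (mu (ball01 x r))].

Lemma upper_exponentS Phi mu d D : d <= D ->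
  upper_exponent Phi mu d -> upper_exponent Phi mu D.
Proof.
move=> dD [C1 [C2 [C10 C20 h]]]; exists C1, C2; split=> // r rho x r0 h1 h2 h3 h4.
apply: le_trans (h _ _ _ r0 h1 h2 h3 h4) _; rewrite ler_pM2l//.
by apply: ler_powR => //; rewrite ler_pdivlMr// mul1r (le_trans (ltW h1)).
Qed.

Lemma lower_exponentS Phi mu d D : D <= d ->
  lower_exponent Phi mu d -> lower_exponent Phi mu D.
Proof.
move=> dD [C1 [C2 [C10 C20 h]]]; exists C1, C2; split=> // r rho x r0 h1 h2 h3 h4.
apply: le_trans (h _ _ _ r0 h1 h2 h3 h4); rewrite ler_pM2l//.
by apply: ler_powR => //; rewrite ler_pdivlMr// mul1r (le_trans (ltW h1)).
Qed.

Lemma upper_dim_le Phi mu D : upper_exponent Phi mu D ->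
  (upper_Phi_dim Phi mu <= D%:E)%E.
Proof. by move=> h; apply: ereal_inf_lbound; exists D. Qed.

Lemma lower_dim_ge Phi mu D : lower_exponent Phi mu D ->
  (D%:E <= lower_Phi_dim Phi mu)%E.
Proof. by move=> h; apply: ereal_sup_ubound; exists D. Qed.

(** The exponents excluded here increase to [D] while staying positive, so that
    powers with these exponents are monotone in the base. *)
Lemma upper_dim_ge Phi mu D : 0 < D ->
  (forall n : nat, ~ upper_exponent Phi mu (D * (1 - n.+2%:R^-1))) ->
  (D%:E <= upper_Phi_dim Phi mu)%E.
Proof.
move=> D0 h; apply: le_ereal_inf_tmp => _ [d hd <-]; rewrite lee_fin leNgt.
apply/negP => dD; pose e := (D - d) / D.
have e0 : 0 < e by rewrite divr_gt0// subr_gt0.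
have [n hn] : exists n : nat, n.+2%:R^-1 < e.
  exists (Num.bound e^-1); rewrite invf_plt ?posrE// ?ltr0n//.
  apply: lt_le_trans (archi_boundP (ltW _)) _; first by rewrite invr_gt0.
  by rewrite ler_nat -addn2 leq_addr.
apply: (h n); apply: upper_exponentS hd.
have -> : d = D * (1 - e) by rewrite /e; field; rewrite gt_eqF.
by rewrite ler_pM2l// lerD2l lerN2 ltW.
Qed.

Lemma lower_dim_le Phi mu D : 0 < D ->
  (forall n : nat, ~ lower_exponent Phi mu (D * (1 + n.+1%:R^-1))) ->
  (lower_Phi_dim Phi mu <= D%:E)%E.
Proof.
move=> D0 h; apply: ge_ereal_sup => _ [d hd <-]; rewrite lee_fin leNgt.
apply/negP => dD; pose e := (d - D) / D.
have e0 : 0 < e by rewrite divr_gt0// subr_gt0.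
have [n hn] : exists n : nat, n.+1%:R^-1 < e.
  exists (Num.bound e^-1); rewrite invf_plt ?posrE// ?ltr0n//.
  apply: lt_le_trans (archi_boundP (ltW _)) _; first by rewrite invr_gt0.
  by rewrite ler_nat leqnSn.
apply: (h n); apply: lower_exponentS hd.
have -> : d = D * (1 + e) by rewrite /e; field; rewrite gt_eqF.
by rewrite ler_pM2l// lerD2l ltW.
Qed.

End Exponents.

(** * Exponents valid at every scale *)

Section UniformBounds.
Context {R : realType} d (U : measurableType d) (K : nat) (A B tau : R)
  (S : 'I_K -> U -> R -> R) (a : 'I_K -> U -> R)
  (hIFS : random_ifs A B tau S a) (u : nat -> U).
Context (q : nat -> 'I_K -> R) (mu : probability (measurableTypeR R) R).
Implicit Types (c e : nat -> 'I_K) (n k : nat) (x y r : R).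
Context (q_ge0 : forall k j, 0 <= q k j) (q_sum1 : forall k, \sum_(j < K) q k j = 1)
  (mu_cyl : forall c n, mu (cyl S u c n) = (mass q c n)%:E).

Notation cyl := (cyl S u).
Notation len := (len a u).
Notation mass := (mass q).

Lemma mass_ge0 c n : 0 <= mass c n.
Proof. by apply: prodr_ge0. Qed.

(** Multiplying the stepwise comparison [theta * a ^ D <= q] over a window of
    letters compares the mass ratio with the [D]-th power of the length ratio. *)
Lemma mass_window_ge c k m (theta D : R) : 0 <= theta ->
  (forall i, (k <= i < k + m)%N -> theta * a (c i) (u i) `^ D <= q i (c i)) ->
  mass c k * (theta ^+ m * len c (k + m) `^ D) <= mass c (k + m) * len c k `^ D.
Proof.
move=> t0; elim: m => [|m ih] h; first by rewrite addn0 expr0 mul1r.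
rewrite addnS massS lenS exprSr powRM ?(ltW (len_gt0 hIFS _ _ _)) ?(ltW (factor_gt0 hIFS _ _))//.
have /ih {}ih i : (k <= i < k + m)%N -> theta * a (c i) (u i) `^ D <= q i (c i).
  by move=> /andP[ki im]; apply: h; lia.
have {}h := h (k + m)%N ltac:(lia).
rewrite (_ : mass c k * _ = (mass c k * (theta ^+ m * len c (k + m) `^ D)) *
  (theta * a (c (k + m)%N) (u (k + m)%N) `^ D)); last by ring.
rewrite [X in _ <= X]mulrAC; apply: ler_pM => //; rewrite mulr_ge0 ?mass_ge0//.
  by rewrite mulr_ge0 ?exprn_ge0// powR_ge0.
by rewrite powR_ge0.
Qed.

Lemma mass_window_le c k m (theta D : R) : 0 <= theta ->
  (forall i, (k <= i < k + m)%N -> q i (c i) <= theta * a (c i) (u i) `^ D) ->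
  mass c (k + m) * len c k `^ D <= mass c k * (theta ^+ m * len c (k + m) `^ D).
Proof.
move=> t0; elim: m => [|m ih] h; first by rewrite addn0 expr0 mul1r.
rewrite addnS massS lenS exprSr powRM ?(ltW (len_gt0 hIFS _ _ _)) ?(ltW (factor_gt0 hIFS _ _))//.
have /ih {}ih i : (k <= i < k + m)%N -> q i (c i) <= theta * a (c i) (u i) `^ D.
  by move=> /andP[ki im]; apply: h; lia.
have {}h := h (k + m)%N ltac:(lia).
rewrite (_ : mass c k * (_ * _) = (mass c k * (theta ^+ m * len c (k + m) `^ D)) *
  (theta * a (c (k + m)%N) (u (k + m)%N) `^ D)); last by ring.
by rewrite [X in X <= _]mulrAC; apply: ler_pM => //; rewrite mulr_ge0 ?mass_ge0// powR_ge0.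
Qed.

(** The level [n] at which the cylinders along [c] first become shorter than [s];
    the bound [n <= M] keeps it within the levels where [c] is known to follow a
    given point. *)
Lemma first_shorter c M s : B ^+ M < s ->
  exists n, [/\ (n <= M)%N, len c n < s & forall k, (k < n)%N -> s <= len c k].
Proof.
move=> Ms; have ex : exists n, len c n < s.
  by exists M; exact: le_lt_trans (len_le hIFS _ _ _) Ms.
case: (ex_minnP ex) => n hn hmin; exists n; split=> //.
  by apply: hmin; exact: le_lt_trans (len_le hIFS _ _ _) Ms.
by move=> k kn; rewrite leNgt; apply/negP => /hmin; rewrite leqNgt kn.
Qed.

Lemma len_first c n s : s <= 1 -> (forall k, (k < n)%N -> s <= len c k) ->
  A * s <= len c n.
Proof.
have A0 := ifs_A_gt0 hIFS; case: n => [|n] s1 h; last first.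
  by apply: le_trans (len_geA hIFS u c n); rewrite ler_pM2l// h.
rewrite len0; apply: le_trans (_ : A * 1 <= _); first by rewrite ler_pM2l.
by rewrite mulr1 ltW// (A_lt1 hIFS).
Qed.

(** A ball of radius [rho] lies, up to a null set, in the first cylinder shorter
    than [rho / tau], and a ball of radius [r] contains the first cylinder
    shorter than [r]. The letters in between compare masses with lengths, and
    both lengths agree with the radii up to constants. *)
Lemma upper_exponent_uniform (Phi : R -> R) (D : R) : 0 <= D ->
  (forall k j, a j (u k) `^ D <= q k j) -> upper_exponent Phi mu D.
Proof.
move=> D0 qa; have A0 := ifs_A_gt0 hIFS; have t0 := ifs_tau_gt0 hIFS.
have t1 := tau_lt1 hIFS.
exists 1, ((tau * A)^-1 `^ D); split => //; first by rewrite powR_gt0// invr_gt0 mulr_gt0.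
move=> r rho x r0 h1 h2 rho1 xs; have rrho := lt_le_trans h1 h2.
have rho0 := lt_trans r0 rrho.
have [M hM] := expB_lt hIFS r0; have [c xc] := supp_cyl hIFS q_sum1 mu_cyl M xs.
have rt : rho <= rho / tau by rewrite ler_pdivlMr// ler_piMr// ltW.
have [n [nM hn hn']] := @first_shorter c M (rho / tau) ltac:(lra).
have [m [mM hm hm']] := first_shorter c hM.
have nm : (n <= m)%N.
  by rewrite leqNgt; apply/negP => /hn'; lra.
have Arm := len_first (le_trans (ltW rrho) rho1) hm'.
have lm0 := len_gt0 hIFS u c m.
have b1 : fine (mu (ball01 x rho)) <= mass c n.
  apply: (ball_mass_le hIFS q_sum1 mu_cyl (cyl_sub hIFS nM xc)) => k kn.
  by rewrite mulrC -ler_pdivrMr// hn'.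
have b2 : mass c m <= fine (mu (ball01 x r)).
  exact: (ball_mass_ge hIFS mu_cyl (cyl_sub hIFS mM xc)).
have br := supp_ball_gt0 xs r0.
have rr0 : 0 <= rho / r by rewrite divr_ge0// ltW.
have tA0 : 0 <= (tau * A)^-1 by rewrite invr_ge0 mulr_ge0// ltW.
rewrite -powRM// ler_pdivrMr//.
set X := _^-1 * _.
have hX : len c n <= X * len c m.
  apply: le_trans (ltW hn) _; rewrite /X.
  rewrite (_ : rho / tau = (tau * A)^-1 * (rho / r) * (A * r)); last first.
    by field; rewrite !gt_eqF.
  by rewrite ler_wpM2l// mulr_ge0.
have X0 : 0 <= X by rewrite mulr_ge0.
have lD : 0 < len c m `^ D by rewrite powR_gt0.
rewrite -(ler_pM2r lD).
apply: le_trans (ler_wpM2r (ltW lD) b1) _.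
have := @mass_window_ge c n (m - n) 1 D ler01.
rewrite subnKC// expr1n mul1r => /(_ _) w.
apply: le_trans (w _) _; first by move=> i _; rewrite mul1r.
rewrite (_ : _ * _ * len c m `^ D = fine (mu (ball01 x r)) * (X * len c m) `^ D); last first.
  by rewrite (powRM _ X0 (ltW lm0)); ring.
apply: ler_pM => //; rewrite ?mass_ge0 ?powR_ge0//.
apply: (ge0_ler_powR D0 _ _ hX); rewrite nnegrE.
  exact: ltW (len_gt0 hIFS u c n).
exact: mulr_ge0 X0 (ltW lm0).
Qed.

(** Dual to the previous bound: now the large ball must contain a cylinder and
    the small one must lie in a cylinder. The two levels may come in the wrong
    order, but then [rho / r] is bounded and monotonicity of [mu] suffices. *)
Lemma lower_exponent_uniform (Phi : R -> R) (D : R) : 0 <= D ->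
  (forall k j, q k j <= a j (u k) `^ D) -> lower_exponent Phi mu D.
Proof.
move=> D0 qa; have A0 := ifs_A_gt0 hIFS; have t0 := ifs_tau_gt0 hIFS.
have t1 := tau_lt1 hIFS.
exists 1, ((tau * A) `^ D); split => //; first by rewrite powR_gt0// mulr_gt0.
move=> r rho x r0 h1 h2 rho1 xs; have rrho := lt_le_trans h1 h2.
have rho0 := lt_trans r0 rrho.
have [M hM] := expB_lt hIFS r0; have [c xc] := supp_cyl hIFS q_sum1 mu_cyl M xs.
have rt : r <= r / tau by rewrite ler_pdivlMr// ler_piMr// ltW.
have [n [nM hn hn']] := @first_shorter c M rho ltac:(lra).
have [m [mM hm hm']] := @first_shorter c M (r / tau) ltac:(lra).
have Arn := len_first rho1 hn'.
have lm0 := len_gt0 hIFS u c m.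
have b1 : mass c n <= fine (mu (ball01 x rho)).
  exact: (ball_mass_ge hIFS mu_cyl (cyl_sub hIFS nM xc)).
have b2 : fine (mu (ball01 x r)) <= mass c m.
  apply: (ball_mass_le hIFS q_sum1 mu_cyl (cyl_sub hIFS mM xc)) => k km.
  by rewrite mulrC -ler_pdivrMr// hm'.
have br := supp_ball_gt0 xs r0.
have rr0 : 0 <= rho / r by rewrite divr_ge0// ltW.
have tA0 : 0 <= tau * A by rewrite mulr_ge0// ltW.
rewrite -powRM// ler_pdivlMr//.
set X := _ * (rho / r).
have X0 : 0 <= X by rewrite mulr_ge0.
have [nm|mn] := leqP n m; last first.
  apply: le_trans (ball_mono mu x (ltW rrho)).
  rewrite ler_piMl ?(ltW br)//.
  have hr : tau * rho <= r.
    by rewrite mulrC -ler_pdivlMr//; have := hn' _ mn; lra.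
  have X1 : X <= 1.
    rewrite /X (_ : _ * _ = A * (tau * rho) / r); last by ring.
    rewrite ler_pdivrMr// mul1r; apply: le_trans hr.
    by rewrite ler_piMl ?mulr_ge0 ?(ltW t0) ?(ltW rho0)// ltW// (A_lt1 hIFS).
  have := ge0_ler_powR D0 _ _ X1; rewrite powR1; apply; rewrite nnegrE//.
have hX : X * len c m <= len c n.
  apply: le_trans Arn; rewrite /X.
  rewrite (_ : A * rho = tau * A * (rho / r) * (r / tau)); last first.
    by field; rewrite !gt_eqF.
  by rewrite ler_wpM2l// ltW.
have lD : 0 < len c m `^ D by rewrite powR_gt0.
rewrite -(ler_pM2r lD).
apply: le_trans (ler_wpM2r (ltW lD) b1).
have := @mass_window_le c n (m - n) 1 D ler01.
rewrite subnKC// expr1n mul1r => /(_ _) w.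
apply: le_trans (w _); last by move=> i _; rewrite mul1r.
rewrite (_ : _ * _ * len c m `^ D = fine (mu (ball01 x r)) * (X * len c m) `^ D); last first.
  by rewrite (powRM _ X0 (ltW lm0)); ring.
apply: ler_pM => //; rewrite ?(ltW br) ?powR_ge0//.
apply: (ge0_ler_powR D0 _ _ hX); rewrite nnegrE.
  exact: mulr_ge0 X0 (ltW lm0).
exact: ltW (len_gt0 hIFS u c n).
Qed.

End UniformBounds.

(** * Scales allowed by a small dimension function *)

Section Scales.
Context {R : realType}.
Implicit Types (Phi : R -> R).

(** For a small [Phi], [t ^ Phi t] is [|ln t| ^ (- H t)] with [H t] tending to 0:
    it decays more slowly than any negative power of [|ln t|]. *)
Lemma small_powR_ge Phi (eta : R) : small_dimension_function Phi -> 0 < eta ->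
  exists2 s, 0 < s & forall t, 0 < t -> t < s ->
    [/\ 0 <= ln (- ln t), t `^ (1 + Phi t) <= t &
      t * expR (- (eta * ln (- ln t))) <= t `^ (1 + Phi t)].
Proof.
move=> [[Phi0 _ _] [H [PhiH H0]]] eta0.
have Hs : \forall t \near 0^'+, `|H t| < eta.
  have /cvgrPdist_lt/(_ _ eta0) := H0; apply: filterS => t; by rewrite sub0r normrN.
have e1 : \forall t \near (0 : R)^'+, t < expR (- 1) by apply: nbhs_right_lt; exact: expR_gt0.
have [s /= s0 hs] : \forall t \near (0 : R)^'+, [/\ `|H t| < eta, t < expR (- 1) &
   Phi t = H t * (ln `|ln t| / `|ln t|)].
  by near=> t; split; near: t.
exists s => // t t0 ts; have [] := hs t _ t0.
  by rewrite /ball/= sub0r normrN gtr0_norm.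
move=> Ht te Phit.
have lt1 : ln t < - 1 by rewrite -(expRK (- 1)) ltr_ln ?posrE ?expR_gt0.
have t1 : t < 1 by apply: lt_trans te _; rewrite -[ltRHS]expR0 ltr_expR; lra.
have nl : `|ln t| = - ln t by rewrite ltr0_norm//; lra.
have l0 : 0 <= ln (- ln t) by apply: ln_ge0; lra.
have P0 : 0 <= Phi t by apply: Phi0; rewrite t0 t1.
have tE : t `^ (1 + Phi t) = t * expR (Phi t * ln t).
  by rewrite /powR gt_eqF// mulrDl mul1r expRD lnK ?posrE.
split=> //; rewrite tE.
  rewrite ger_pMr// -[leRHS]expR0 ler_expR mulr_ge0_le0//; lra.
rewrite ler_pM2l// ler_expR Phit nl.
rewrite (_ : H t * _ * _ = - (H t * ln (- ln t))); last by field; rewrite lt_eqF; lra.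
by rewrite lerN2 ler_wpM2r// (le_trans (ler_norm _))// ltW.
Unshelve. all: by end_near. Qed.

(** At a level [n <= m * b ^ m] the scale [R = c1 * l] has [ln |ln R|] of order
    at most [m], so [R ^ Phi R] is at least [exp (- eta * m)] with [eta] as small
    as one likes, whereas [m] further letters divide the length by at least
    [B ^ - m]. A window of [m] letters is thus long enough to be seen by the
    dimension. *)
Lemma small_window Phi (A B c1 c2 C1 : R) (b : nat) :
  small_dimension_function Phi -> 0 < A -> A < 1 -> 0 < B -> B < 1 ->
  0 < c1 -> 0 < c2 -> 0 < C1 ->
  exists M, forall m n (l l' : R), (M <= m)%N -> (m <= n <= b ^ m * m)%N ->
    A ^+ n <= l -> l <= B ^+ n -> l' <= l * B ^+ m ->
    [/\ c2 * l' < (c1 * l) `^ (1 + Phi (c1 * l)),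
        (c1 * l) `^ (1 + Phi (c1 * l)) <= c1 * l & c1 * l <= C1].
Proof.
move=> sPhi A0 A1 B0 B1 c10 c20 C10.
pose C := `|ln c1| - ln A.
have lA : ln A < 0 by rewrite ln_lt0// A0 A1.
have C0 : 0 < C by have := normr_ge0 (ln c1); rewrite /C; lra.
pose w : R := ln (2 * b)%:R.
(* [lambda * m] bounds [ln |ln R|] at the levels considered *)
pose lambda := `|w| + `|ln C| + 1.
have lam0 : 0 < lambda by rewrite /lambda ltr_wpDl// addr_ge0.
pose beta := - ln B.
have beta0 : 0 < beta by rewrite oppr_gt0 ln_lt0// B0 B1.
(* half of the decay [B ^ m] pays for [R ^ Phi R], the other half for [c2 / c1] *)
pose eta := beta / (2 * lambda).
have eta0 : 0 < eta by rewrite divr_gt0// mulr_gt0.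
have [s s0 hs] := small_powR_ge sPhi eta0.
pose s1 := Num.min (s / c1) (C1 / c1).
have s10 : 0 < s1 by rewrite lt_min !divr_gt0.
have [N hN] := expr_lt_eventually B0 B1 s10.
pose N2 := Num.bound (2 * (c2 / c1) / beta).
exists (maxn (maxn N N2) 1%N) => m n l l'.
rewrite !geq_max => /andP[/andP[Nm N2m] m1] /andP[mn nb] lge lle l'le.
have l0 : 0 < l by apply: lt_le_trans lge; rewrite exprn_gt0.
have n1 : (0 < n)%N by exact: leq_trans mn.
have lm : l < s1.
  by apply: le_lt_trans lle _; apply: hN; exact: leq_trans mn.
move: lm; rewrite lt_min !ltr_pdivlMr// ![l * _]mulrC => /andP[ls lC].
have t0 : 0 < c1 * l by rewrite mulr_gt0.
have [h1 h2 h3] := hs _ t0 ls; split=> //; last exact: ltW.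
apply: lt_le_trans h3; set L := ln (- ln (c1 * l)) in h1 *.
have LE : - ln (c1 * l) <= n%:R * C.
  rewrite lnM ?posrE//.
  have : - ln l <= n%:R * - ln A.
    by rewrite mulrN lerN2 mulr_natl -lnXn// ler_ln ?posrE ?exprn_gt0.
  have : - ln c1 <= `|ln c1| * n%:R.
    apply: (@le_trans _ _ `|ln c1|); first by rewrite -normrN ler_norm.
    by rewrite ler_peMr// ler1n.
  by rewrite /C; lra.
have Lm : L <= lambda * m%:R.
  have [lt0|lt0] := leP (- ln (c1 * l)) 0.
    by rewrite /L ln0// mulr_ge0// ltW.
  apply: (@le_trans _ _ (ln (n%:R * C))).
    by rewrite ler_ln ?posrE// mulr_gt0// ltr0n.
  rewrite lnM ?posrE ?ltr0n//.
  have : ln (n%:R : R) <= m%:R * w.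
    have b0 : (0 < b)%N.
      by case: (b) nb m1 n1 => [|//]; case: (m) => // m'; rewrite exp0n// mul0n; case: (n).
    rewrite /w mulr_natl -lnXn ?ltr0n ?muln_gt0//.
    rewrite ler_ln ?posrE ?ltr0n// ?exprn_gt0 ?ltr0n ?muln_gt0//.
    rewrite -natrX ler_nat; apply: leq_trans nb _.
    by rewrite expnMn mulnC leq_mul2r (ltnW (ltn_expl _ _)) ?orbT.
  have : m%:R * w <= m%:R * `|w| by rewrite ler_wpM2l// ler_norm.
  have : ln C <= m%:R * `|ln C|.
    by apply: le_trans (ler_norm _) _; rewrite ler_peMl// ler1n.
  have : 0 <= m%:R :> R by [].
  by rewrite /lambda; lra.
have etaL : eta * L <= beta / 2 * m%:R.
  apply: le_trans (ler_wpM2l (ltW eta0) Lm) _.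
  rewrite /eta le_eqVlt; apply/orP; left; apply/eqP; field.
  by rewrite gt_eqF.
apply: (@lt_le_trans _ _ (c1 * l * expR (- (beta / 2 * m%:R)))); last first.
  by rewrite ler_pM2l// ler_expR lerN2.
apply: (@le_lt_trans _ _ (c2 * (l * B ^+ m))); first by rewrite ler_pM2l.
have -> : B ^+ m = expR (- (beta / 2 * m%:R)) * expR (- (beta / 2 * m%:R)).
  rewrite -expRD -{1}(lnK (x := B)) ?posrE// -expRM_natr; congr expR.
  by rewrite /beta; field.
set E := expR _.
have E0 : 0 < E by exact: expR_gt0.
rewrite (_ : c2 * _ = (l * E) * (c2 * E)); last by ring.
rewrite (_ : c1 * l * E = (l * E) * c1); last by ring.
rewrite ltr_pM2l ?mulr_gt0//.
rewrite /E expRN ltr_pdivrMr ?expR_gt0// mulrC -ltr_pdivrMr//.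
apply: lt_le_trans (expR_ge1Dx _).
have : 2 * (c2 / c1) / beta < m%:R.
  apply: lt_le_trans (archi_boundP _) _; first by rewrite !mulr_ge0 ?invr_ge0// ltW.
  by rewrite ler_nat.
by rewrite ltr_pdivrMr//; lra.
Qed.

End Scales.

(** * Long runs in an independent sequence *)

Section Windows.
Context {R : realType} d (T : measurableType d) (P0 : set T -> \bar R)
  (PP : probability (sequence_space T) R) (hPP : is_infinite_power P0 PP).
Implicit Types (H M m k n : nat) (F : nat -> set T) (G : set T).

(** [F] is indexed by all of [nat] so that the horizon [H] can stay fixed while
    the constraints on single coordinates change. *)
Definition rect H F : set (nat -> T) := [set w | forall i : 'I_H, F i (w i)].

Lemma coordinate_measurable n G : measurable G ->
  measurable ([set w | G (w n)] : set (sequence_space T)).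
Proof. by move=> mG; apply: sub_sigma_algebra; exists n, G. Qed.

Lemma rect_measurable H F : (forall i, measurable (F i)) ->
  measurable (rect H F : set (sequence_space T)).
Proof.
move=> mF; rewrite (_ : rect H F = \bigcap_(i : 'I_H) [set w | F i (w i)]).
  by apply: fin_bigcap_measurable => // i _; exact: coordinate_measurable.
by apply/seteqP; split=> w; [move=> h i _; exact: h|move=> h i; exact: h].
Qed.

Lemma rect_prob H F : (forall i, measurable (F i)) ->
  PP (rect H F) = (\prod_(i < H) P0 (F i))%E.
Proof. by move=> mF; exact: (hPP (A := fun i : 'I_H => F i)). Qed.

Lemma coordinate_prob n G : measurable G -> P0 setT = 1%E ->
  PP [set w | G (w n)] = P0 G.
Proof.
move=> mG P1; pose F i := if i == n then G else setT.
have := @rect_prob n.+1 F _; rewrite big_ord_recr/= big1 => [|i _]; last first.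
  by rewrite /F ltn_eqF.
rewrite mul1e {3}/F eqxx => <-; last first.
  by move=> i; rewrite /F; case: ifP => // _; exact: measurableT.
congr (PP _); apply/seteqP; split=> w /=.
  by move=> h i; rewrite /F; case: eqP => // ->.
by move=> /(_ ord_max) /=; rewrite /F eqxx.
Qed.

(** [P0] is a bare set function, whose properties are those of a coordinate
    under the infinite power. *)
Lemma base_setT : P0 setT = 1%E.
Proof.
have := @rect_prob 1 (fun=> setT) (fun=> measurableT); rewrite big_ord1 => <-.
by rewrite (_ : rect _ _ = setT) ?probability_setT//; apply/seteqP; split.
Qed.

Lemma base_real G : measurable G -> exists q : R, [/\ P0 G = q%:E, 0 <= q & q <= 1].
Proof.
move=> mG; rewrite -(coordinate_prob 0 mG base_setT).
have mc := coordinate_measurable 0 mG.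
exists (fine (PP [set w | G (w 0%N)])); rewrite fineK ?fin_num_measure//.
split=> //; first exact: fine_ge0.
by rewrite -lee_fin fineK ?fin_num_measure//; exact: probability_le1.
Qed.

(** The blocks are disjoint, hence independent; block 0 is left out so that the
    blocks of length [m] start at an index at least [m]. *)
Definition no_run G m k : set (nat -> T) :=
  [set w | forall l, (0 < l <= k)%N ->
    ~ forall i, (l * m <= i < l * m + m)%N -> G (w i)].

Definition force F G s m : nat -> set T :=
  fun i => if (s <= i < s + m)%N then G else F i.

Lemma force_measurable F G s m : measurable G -> (forall i, measurable (F i)) ->
  forall i, measurable (force F G s m i).
Proof. by move=> mG mF i; rewrite /force; case: ifP. Qed.

(** On the window [F] imposed nothing, so forcing [G] there multiplies the
    probability by one factor [q] per index. *)
Lemma rect_force_prob H F G s m (q : R) : measurable G ->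
  (forall i, measurable (F i)) -> P0 G = q%:E -> (s + m <= H)%N ->
  (forall i, (i < s + m)%N -> F i = setT) ->
  PP (rect H (force F G s m)) = ((q ^+ m)%:E * PP (rect H F))%E.
Proof.
move=> mG mF Gq sH Ft; rewrite !rect_prob//; last exact: force_measurable.
rewrite -!(big_mkord xpredT (fun i => P0 (_ i))).
rewrite !(@big_cat_nat _ _ _ (s + m)%N 0%N H)//= !(@big_cat_nat _ _ _ s 0%N (s + m)%N) ?leq_addr//=.
have -> : (\prod_(0 <= i < s) P0 (force F G s m i) = 1)%E.
  rewrite big_nat_cond big1// => i /andP[/andP[_ is_] _].
  by rewrite /force leqNgt is_/= Ft ?base_setT// ltn_addr.
have -> : (\prod_(0 <= i < s) P0 (F i) = 1)%E.
  rewrite big_nat_cond big1// => i /andP[/andP[_ is_] _].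
  by rewrite Ft ?base_setT// ltn_addr.
have -> : (\prod_(s <= i < s + m) P0 (F i) = 1)%E.
  rewrite big_nat_cond big1// => i /andP[/andP[_ is_] _].
  by rewrite Ft ?base_setT.
have -> : (\prod_(s <= i < s + m) P0 (force F G s m i) = (q ^+ m)%:E)%E.
  rewrite (eq_big_nat _ _ (F2 := fun=> q%:E)) => [|i ism]; last by rewrite /force ism.
  by rewrite prodEFin prodr_const_nat addKn.
rewrite !mul1e; congr (_ * _)%E; apply: eq_big_nat => i /andP[smi _].
by rewrite /force [in X in _ && X]ltnNge smi andbF.
Qed.

Lemma no_run_measurable G m k : measurable G ->
  measurable (no_run G m k : set (sequence_space T)).
Proof.
move=> mG; rewrite (_ : no_run G m k = \bigcap_l
   (if (0 < l <= k)%N then ~` rect (l * m + m)%N (force (fun=> setT) G (l * m) m) else setT)).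
  apply: bigcapT_measurable => l; case: ifP => // _; apply: measurableC.
  by apply: rect_measurable; apply: force_measurable => // i; exact: measurableT.
apply/seteqP; split=> w h.
  move=> l _; case: ifP => // lk hl; apply: (h _ lk) => i li.
  have /andP[_ iH] := li; have := hl (Ordinal iH); by rewrite /force/= li.
move=> l lk hl; have := h l I; rewrite lk; apply=> i; rewrite /force.
by case: ifP => // /hl.
Qed.

(** Independence of the first [k] blocks from any event on later coordinates.
    The extra event [rect H F] makes the induction work: the event that block
    [k + 1] is a run is itself such a rectangle. *)
Lemma no_run_prob_rect G m H k F (q : R) : measurable G -> P0 G = q%:E ->
  (forall i, measurable (F i)) -> (k * m + m <= H)%N ->
  (forall i, (i < k * m + m)%N -> F i = setT) ->
  PP (no_run G m k `&` rect H F) = (((1 - q ^+ m) ^+ k)%:E * PP (rect H F))%E.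
Proof.
move=> mG Gq; elim: k F => [|k ih] F mF kH Ft.
  rewrite (_ : no_run G m 0 = setT) ?setTI ?expr0 ?mul1e//.
  by apply/seteqP; split=> // w _ l; lia.
pose F' := force F G (k.+1 * m) m.
have mF' : forall i, measurable (F' i) by exact: force_measurable.
have e : no_run G m k.+1 `&` rect H F =
    (no_run G m k `&` rect H F) `\` (no_run G m k `&` rect H F').
  apply/seteqP; split=> w.
    move=> [hw wF]; split; first by split=> // l lk; apply: hw; lia.
    move=> [_ wF']; apply: (hw k.+1); first by rewrite ltnSn.
    move=> i ik; have iH : (i < H)%N by move/andP: ik; lia.
    by have := wF' (Ordinal iH); rewrite /F' /force/= ik.
  move=> [[hw wF] hn]; split=> // l /andP[l0]; rewrite leq_eqVlt => /orP[/eqP ->|lk]; last first.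
    by apply: hw; rewrite l0.
  move=> hr; apply: hn; split=> // i; rewrite /F' /force; case: ifP => // ik; exact: hr.
have sub : no_run G m k `&` rect H F' `<=` no_run G m k `&` rect H F.
  move=> w [hw wF']; split=> // i; have := wF' i; rewrite /F' /force; case: ifP => // ik _.
  by rewrite Ft//; move/andP: ik => [].
have km : (k * m + m <= H)%N by apply: leq_trans kH; rewrite mulSn; lia.
have Ft' i : (i < k * m + m)%N -> F i = setT.
  by move=> ik; apply: Ft; rewrite mulSn; lia.
have mn := no_run_measurable m k mG.
have mr := rect_measurable H mF; have mr' := rect_measurable H mF'.
have ih1 := ih F mF km Ft'.
have ih2 := ih F' mF' km.
have -> : PP (no_run G m k.+1 `&` rect H F) =
    (PP (no_run G m k `&` rect H F) - PP (no_run G m k `&` rect H F'))%E.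
  rewrite e measureD; [by rewrite (setIidr sub)|exact: measurableI|exact: measurableI|].
  by rewrite ltey_eq fin_num_measure//; exact: measurableI.
rewrite ih1 ih2; last first.
  move=> i ik; rewrite /F' /force ifF; first exact: Ft'.
  by rewrite mulSn addnC leqNgt ik.
rewrite (rect_force_prob mG mF Gq kH Ft) -(@fineK _ (PP (rect H F))) ?fin_num_measure//.
by rewrite -!EFinM -EFinB; congr EFin; rewrite exprS; ring.
Qed.

Lemma no_run_prob G m k (q : R) : measurable G -> P0 G = q%:E ->
  PP (no_run G m k) = ((1 - q ^+ m) ^+ k)%:E.
Proof.
move=> mG Gq.
have := @no_run_prob_rect G m (k * m + m)%N k (fun=> setT) q mG Gq
  (fun=> measurableT) (leqnn _) (fun _ _ => erefl).
rewrite (_ : rect _ _ = setT); last by apply/seteqP; split.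
by rewrite setIT probability_setT mule1.
Qed.

(** If [q] is the probability of [G] and [b * q >= 2], none of the [b ^ m] blocks
    of length [m] is a run with probability [(1 - q ^ m) ^ (b ^ m)], at most
    [1 / (1 + 2 ^ m)]. Hence this happens for all large [m] with probability 0. *)
Lemma long_runs G : measurable G -> (0 < P0 G)%E -> exists b : nat,
  {ae PP, forall w, forall M, exists m, (M <= m)%N /\ exists k,
    (0 < k <= b ^ m)%N /\ forall i, (k * m <= i < k * m + m)%N -> G (w i)}.
Proof.
move=> mG; have [q [Gq q0 q1]] := base_real mG; rewrite Gq lte_fin => {}q0.
pose b := Num.bound (2 / q).
have bq : 2 <= b%:R * q.
  by rewrite -ler_pdivrMr// ltW// archi_boundP// divr_ge0// ltW.
exists b; apply/ae_foralln => M.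
pose N := \bigcap_m no_run G (M + m) (b ^ (M + m)).
have mN : measurable (N : set (sequence_space T)).
  by apply: bigcapT_measurable => m; exact: no_run_measurable.
exists N; split=> //; last first.
  move=> w /= hw m _ l lb hl; apply: hw; exists (M + m)%N; split; first exact: leq_addr.
  by exists l.
have mle m : (PP N <= (m.+1%:R^-1)%:E)%E.
  apply: (@le_trans _ _ (PP (no_run G (M + m) (b ^ (M + m))))).
    apply: le_measure; rewrite ?inE//; first exact: no_run_measurable.
    by move=> w; apply.
  rewrite (no_run_prob _ _ mG Gq) lee_fin.
  apply: le_trans (expr_1B_le _ _ _) _; [by rewrite exprn_ge0// ltW|by rewrite exprn_ile1// ltW|].
  rewrite lef_pV2 ?posrE ?ltr0n//; last first.
    by rewrite ltr_pwDl// mulr_ge0// exprn_ge0// ltW.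
  rewrite natrX -exprMn -[m.+1]add1n natrD lerD2l.
  apply: (@le_trans _ _ (2 ^+ (M + m))); last by rewrite lerXn2r ?nnegrE// (le_trans _ bq).
  rewrite -natrX ler_nat; apply: leq_trans (ltnW (ltn_expl _ _)) => //.
  exact: leq_addl.
apply/eqP; rewrite eq_le measure_ge0 andbT; apply/lee_addgt0Pr => e e0.
rewrite add0e; apply: le_trans (mle (Num.bound e^-1)) _; rewrite lee_fin invf_ple ?posrE ?ltr0n//.
apply: le_trans (ltW (archi_boundP _)) _; first by rewrite invr_ge0 ltW.
by rewrite ler_nat leqnSn.
Qed.

End Windows.

(** * Long runs exclude exponents *)

Section RunsExcludeExponents.
Context {R : realType} d (U : measurableType d) (K : nat) (A B tau : R)
  (S : 'I_K -> U -> R -> R) (a : 'I_K -> U -> R)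
  (hIFS : random_ifs A B tau S a) (u : nat -> U).
Context (q : nat -> 'I_K -> R) (mu : probability (measurableTypeR R) R).
Context (q_ge0 : forall k j, 0 <= q k j) (q_sum1 : forall k, \sum_(j < K) q k j = 1)
  (mu_cyl : forall c n, mu (cyl S u c n) = (mass q c n)%:E).
Context (j : 'I_K) (qj_gt0 : forall k, 0 < q k j).
Implicit Types (k m n M b : nat) (Phi : R -> R).

Notation cyl := (cyl S u).
Notation len := (len a u).
Notation mass := (mass q).
(* the point with this constant address witnesses every failure below *)
Let c : nat -> 'I_K := fun=> j.

Lemma len_ratio_powR n m (D : R) :
  (len c n / len c m) `^ D * len c m `^ D = len c n `^ D.
Proof.
have := len_gt0 hIFS u c n; have := len_gt0 hIFS u c m => m0 n0.
by rewrite -powRM ?divr_ge0 ?(ltW m0) ?(ltW n0)// divfK// gt_eqF.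
Qed.

(** Along a run of [m] letters the mass ratio exceeds the [D]-th power of the
    length ratio by a factor [theta ^ - m], which no constant can absorb. *)
Lemma low_mass_run_upper (theta D : R) b Phi : small_dimension_function Phi ->
  0 < theta -> theta < 1 ->
  (forall M, exists m, (M <= m)%N /\ exists k, (0 < k <= b ^ m)%N /\
    forall i, (k * m <= i < k * m + m)%N -> q i j <= theta * a j (u i) `^ D) ->
  ~ upper_exponent Phi mu D.
Proof.
move=> sPhi t0 t1 runs [C1 [C2 [C10 C20 h]]].
have A0 := ifs_A_gt0 hIFS; have ta0 := ifs_tau_gt0 hIFS.
have B0 := B_gt0 hIFS; have B1 := ifs_B_lt1 hIFS.
have [x xc] := cyl_bigcap_neq0 hIFS u c.
have xs : supp01 mu x by apply: (supp_of_cyl hIFS mu_cyl _ xc) => k; exact: qj_gt0.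
(* radius [2 * len c n] exceeds the diameter of the cylinder, and radius
   [tau * len c (n + m)] keeps the ball away from all other cylinders *)
have [M hM] := @small_window R Phi A B 2 tau C1 b sPhi A0 (A_lt1 hIFS) B0 B1
  ltac:(lra) ta0 C10.
pose C3 := C2 * (2 / tau) `^ D.
have C30 : 0 < C3 by rewrite mulr_gt0// powR_gt0// divr_gt0.
have C3i : 0 < C3^-1 by rewrite invr_gt0.
have [N hN] := expr_lt_eventually t0 t1 C3i.
have [m [MNm [k [/andP[k0 kb] run]]]] := runs (maxn M N).
have [Mm Nm] : (M <= m)%N /\ (N <= m)%N by move: MNm; rewrite geq_max => /andP[].
pose n := (k * m)%N.
have ln0 := len_gt0 hIFS u c n; have lnm0 := len_gt0 hIFS u c (n + m).
have [w1 w2 w3] := hM m n (len c n) (len c (n + m)) Mm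
  ltac:(by rewrite /n leq_pmull// leq_mul2r kb orbT)
  (len_ge hIFS u c n) (len_le hIFS u c n) (len_add_le hIFS u c n m).
have := h _ _ _ (mulr_gt0 ta0 lnm0) w1 w2 w3 xs.
have b1 : mass c n <= fine (mu (ball01 x (2 * len c n))).
  by apply: (ball_mass_ge hIFS mu_cyl (xc n)); lra.
have b2 : fine (mu (ball01 x (tau * len c (n + m)))) <= mass c (n + m).
  apply: (ball_mass_le hIFS q_sum1 mu_cyl (xc _)) => i im.
  by rewrite ler_pM2l// (len_noninc hIFS)// ltnW.
rewrite ler_pdivrMr; last by apply: supp_ball_gt0 => //; rewrite mulr_gt0.
have mn0 : 0 < mass c n by apply: mass_gt0 => i _; exact: qj_gt0.
have w := @mass_window_le _ _ _ _ _ _ _ _ _ hIFS u q q_ge0 c n m theta D (ltW t0) run.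
rewrite (_ : 2 * len c n / _ = (2 / tau) * (len c n / len c (n + m))); last first.
  by field; rewrite !gt_eqF.
rewrite powRM ?divr_ge0 ?(ltW ln0) ?(ltW lnm0) ?(ltW ta0)// mulrA -/C3.
set Y := _ `^ D => hb.
have Y0 : 0 <= Y by exact: powR_ge0.
have h1 : mass c n <= C3 * Y * mass c (n + m).
  apply: le_trans b1 _; apply: le_trans hb _.
  by rewrite ler_wpM2l// mulr_ge0// ltW.
have lD0 : 0 < len c (n + m) `^ D by rewrite powR_gt0.
have h2 : mass c n * len c (n + m) `^ D <= C3 * theta ^+ m * (mass c n * len c (n + m) `^ D).
  apply: (@le_trans _ _ (C3 * Y * mass c (n + m) * len c (n + m) `^ D)).
    by rewrite ler_pM2r.
  rewrite (_ : C3 * Y * _ * _ = C3 * (mass c (n + m) * len c n `^ D)); last first.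
    by rewrite -(len_ratio_powR n (n + m)) -/Y; ring.
  rewrite (_ : C3 * theta ^+ m * _ = C3 * (mass c n * (theta ^+ m * len c (n + m) `^ D))); last by ring.
  by rewrite ler_pM2l.
have := hN m Nm; rewrite -[C3^-1]mul1r ltr_pdivlMr// => h3.
have : 0 < mass c n * len c (n + m) `^ D by rewrite mulr_gt0.
move: h2; set z := mass c n * _ => h2 z0.
by move: h2; rewrite leNgt gtr_pMl// mulrC h3.
Qed.

(** Same argument with the roles of the two radii exchanged: the large ball lies
    in a cylinder and the small one contains a cylinder. *)
Lemma high_mass_run_lower (kappa D : R) b Phi : small_dimension_function Phi ->
  1 < kappa ->
  (forall M, exists m, (M <= m)%N /\ exists k, (0 < k <= b ^ m)%N /\
    forall i, (k * m <= i < k * m + m)%N -> kappa * a j (u i) `^ D <= q i j) ->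
  ~ lower_exponent Phi mu D.
Proof.
move=> sPhi kap1 runs [C1 [C2 [C10 C20 h]]].
have kap0 : 0 < kappa by lra.
have A0 := ifs_A_gt0 hIFS; have ta0 := ifs_tau_gt0 hIFS.
have B0 := B_gt0 hIFS; have B1 := ifs_B_lt1 hIFS.
have [x xc] := cyl_bigcap_neq0 hIFS u c.
have xs : supp01 mu x by apply: (supp_of_cyl hIFS mu_cyl _ xc) => k; exact: qj_gt0.
have [M hM] := @small_window R Phi A B tau 2 C1 b sPhi A0 (A_lt1 hIFS) B0 B1
  ta0 ltac:(lra) C10.
pose C3 := C2 * (tau / 2) `^ D.
have C30 : 0 < C3 by rewrite mulr_gt0// powR_gt0// divr_gt0.
have ki0 : 0 < kappa^-1 by rewrite invr_gt0.
have ki1 : kappa^-1 < 1 by rewrite invf_lt1.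
have [N hN] := expr_lt_eventually ki0 ki1 C30.
have [m [MNm [k [/andP[k0 kb] run]]]] := runs (maxn M N).
have [Mm Nm] : (M <= m)%N /\ (N <= m)%N by move: MNm; rewrite geq_max => /andP[].
pose n := (k * m)%N.
have ln0 := len_gt0 hIFS u c n; have lnm0 := len_gt0 hIFS u c (n + m).
have [w1 w2 w3] := hM m n (len c n) (len c (n + m)) Mm
  ltac:(by rewrite /n leq_pmull// leq_mul2r kb orbT)
  (len_ge hIFS u c n) (len_le hIFS u c n) (len_add_le hIFS u c n m).
have l20 : 0 < 2 * len c (n + m) by rewrite mulr_gt0.
have := h _ _ _ l20 w1 w2 w3 xs.
have b1 : mass c (n + m) <= fine (mu (ball01 x (2 * len c (n + m)))).
  by apply: (ball_mass_ge hIFS mu_cyl (xc _)); lra.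
have b2 : fine (mu (ball01 x (tau * len c n))) <= mass c n.
  apply: (ball_mass_le hIFS q_sum1 mu_cyl (xc _)) => i im.
  by rewrite ler_pM2l// (len_noninc hIFS)// ltnW.
rewrite ler_pdivlMr; last exact: supp_ball_gt0.
have mnm0 : 0 < mass c (n + m) by apply: mass_gt0 => i _; exact: qj_gt0.
have w := @mass_window_ge _ _ _ _ _ _ _ _ _ hIFS u q q_ge0 c n m kappa D (ltW kap0) run.
rewrite (_ : tau * len c n / _ = (tau / 2) * (len c n / len c (n + m))); last first.
  by field; rewrite !gt_eqF.
rewrite powRM ?divr_ge0 ?(ltW ln0) ?(ltW lnm0) ?(ltW ta0)// mulrA -/C3.
set Y := _ `^ D => hb.
have Y0 : 0 <= Y by exact: powR_ge0.
have h1 : C3 * Y * mass c (n + m) <= mass c n.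
  apply: le_trans b2; apply: le_trans hb.
  by rewrite ler_wpM2l// mulr_ge0// ltW.
have lD0 : 0 < len c (n + m) `^ D by rewrite powR_gt0.
have lnD0 : 0 < len c n `^ D by rewrite powR_gt0.
have kapm : 0 < kappa ^+ m by rewrite exprn_gt0.
have h2 : C3 * kappa ^+ m * (mass c (n + m) * len c n `^ D) <= mass c (n + m) * len c n `^ D.
  apply: le_trans w.
  rewrite (_ : C3 * _ * _ = (C3 * Y * mass c (n + m)) * (kappa ^+ m * len c (n + m) `^ D)).
    by rewrite ler_pM2r// mulr_gt0.
  by rewrite -(len_ratio_powR n (n + m)) -/Y; ring.
have := hN m Nm; rewrite exprVn -[_^-1]mul1r ltr_pdivrMr// => h3.
have : 0 < mass c (n + m) * len c n `^ D by rewrite mulr_gt0.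
move: h2; set z := mass c _ * _ => h2 z0.
by move: h2; rewrite leNgt ltr_pMl// h3.
Qed.

End RunsExcludeExponents.

(** * Essential bounds and weights *)

Section EssentialBounds.
Context {R : realType} d (U : measurableType d) (P : probability U R) (f : U -> R).
Context (A B : R) (fA : forall u, A <= f u) (fB : forall u, f u <= B)
  (mf : measurable_fun [set: U] f).

Lemma prob_setT_gt0 : (0 < P setT)%E.
Proof. by rewrite probability_setT. Qed.

Let sup := fine (ess_sup P (EFin \o f)).
Let inf := fine (ess_inf P (EFin \o f)).

Lemma ess_supr_bounds : ess_sup P (EFin \o f) = sup%:E /\ A <= sup <= B.
Proof.
have hA : (A%:E <= ess_sup P (EFin \o f))%E.
  by apply: ess_sup_ger => [|t]; [exact: prob_setT_gt0|rewrite lee_fin].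
have hB : (ess_sup P (EFin \o f) <= B%:E)%E.
  by apply: ess_sup_ler => t; rewrite lee_fin.
have e : ess_sup P (EFin \o f) = sup%:E.
  by rewrite fineK// fin_numElt (lt_le_trans (ltNyr A))// (le_lt_trans hB)// ltry.
by split=> //; rewrite -!lee_fin -e hA hB.
Qed.

Lemma ess_infr_bounds : ess_inf P (EFin \o f) = inf%:E /\ A <= inf <= B.
Proof.
have hA : (A%:E <= ess_inf P (EFin \o f))%E.
  by apply: ess_inf_ler => t; rewrite lee_fin.
have hB : (ess_inf P (EFin \o f) <= B%:E)%E.
  rewrite ess_infEN leeNl; apply: ess_sup_gee; first exact: prob_setT_gt0.
  by apply: nearW => t /=; rewrite lee_fin lerN2.
have e : ess_inf P (EFin \o f) = inf%:E.
  by rewrite fineK// fin_numElt (lt_le_trans (ltNyr A))// (le_lt_trans hB)// ltry.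
by split=> //; rewrite -!lee_fin -e hA hB.
Qed.

Lemma measurable_gt (alpha : R) : measurable [set u | alpha < f u].
Proof.
rewrite (_ : [set u | _] = [set: U] `&` f @^-1` `]alpha, +oo[%classic).
  by apply: mf => //; exact: measurable_itv.
by rewrite setTI; apply/seteqP; split=> u /=; rewrite in_itv/= andbT.
Qed.

Lemma measurable_le (alpha : R) : measurable [set u | f u <= alpha].
Proof.
rewrite (_ : [set u | _] = ~` [set u | alpha < f u]).
  exact/measurableC/measurable_gt.
by apply/seteqP; split=> u /=; rewrite leNgt => /negP.
Qed.

Lemma measurable_lt (alpha : R) : measurable [set u | f u < alpha].
Proof.
rewrite (_ : [set u | _] = [set: U] `&` f @^-1` `]-oo, alpha[%classic).
  by apply: mf => //; exact: measurable_itv.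
by rewrite setTI; apply/seteqP; split=> u /=; rewrite in_itv/=.
Qed.

Lemma measurable_ge (alpha : R) : measurable [set u | alpha <= f u].
Proof.
rewrite (_ : [set u | _] = ~` [set u | f u < alpha]).
  exact/measurableC/measurable_lt.
by apply/seteqP; split=> u /=; rewrite leNgt => /negP.
Qed.

Lemma near_ess_sup_prob (alpha : R) : alpha < sup -> (0 < P [set u | (alpha < f u)%R])%E.
Proof.
move=> h; rewrite lt0e measure_ge0 andbT; apply/eqP => P0.
have : (ess_sup P (EFin \o f) <= alpha%:E)%E.
  apply/ess_supP; exists [set u | alpha < f u]; split=> //; first exact: measurable_gt.
  by move=> u /= /negP; rewrite lee_fin -ltNge.
by rewrite ess_supr_bounds.1 lee_fin leNgt h.
Qed.

Lemma near_ess_inf_prob (alpha : R) : inf < alpha -> (0 < P [set u | (f u < alpha)%R])%E.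
Proof.
move=> h; rewrite lt0e measure_ge0 andbT; apply/eqP => P0.
have : (alpha%:E <= ess_inf P (EFin \o f))%E.
  apply/ess_infP; exists [set u | f u < alpha]; split=> //; first exact: measurable_lt.
  by move=> u /= /negP; rewrite lee_fin -ltNge.
by rewrite ess_infr_bounds.1 lee_fin leNgt h.
Qed.

Lemma le_ess_supr_ae : {ae P, forall u, f u <= sup}.
Proof.
have := @ess_sup_ge _ _ _ P (EFin \o f); apply: filterS => u /=.
by rewrite ess_supr_bounds.1 lee_fin.
Qed.

Lemma ge_ess_infr_ae : {ae P, forall u, inf <= f u}.
Proof.
have := @ess_inf_le _ _ _ P (EFin \o f); apply: filterS => u /=.
by rewrite ess_infr_bounds.1 lee_fin.
Qed.

End EssentialBounds.

Section Weights.
Context {R : realType} d (V : measurableType d) (Q : probability V R) (K : nat)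
  (p : 'I_K -> V -> R).

(** A finite negative moment cannot charge the zeros of the weight, where the
    negative power is infinite. *)
Lemma weights_gt0_ae : random_weights Q p -> forall j, {ae Q, forall v, 0 < p j v}.
Proof.
move=> hp j; have [t [t0 ht]] := weights_moment hp.
have mp := weights_measurable hp j.
have mf : measurable_fun [set: V] (fun v => neg_power (p j v) t).
  rewrite (_ : (fun v => _) = fun v => if (p j v <= 0)%R then +oo%E else (p j v `^ (- t))%:E).
    apply: measurable_fun_ifT => //.
      exact: measurable_fun_ler.
    by apply/measurable_EFinP; exact: (measurableT_comp (@measurable_powR R (- t)) mp).
  by apply/funext => v; rewrite /neg_power eq_le (weights_ge0 hp) andbT.
have int : Q.-integrable [set: V] (fun v => neg_power (p j v) t).
  apply/integrableP; split=> //; rewrite (eq_integral (fun v => neg_power (p j v) t)).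
    exact: ht.
  move=> v _; rewrite gee0_abs// /neg_power; case: ifP => _; first exact: leey.
  by rewrite lee_fin powR_ge0.
have := integrable_ae measurableT int; apply: filterS => v /(_ I).
rewrite /neg_power lt_neqAle (weights_ge0 hp)/= andbT eq_sym.
by case: ifP => // _; rewrite fin_numE.
Qed.

Lemma constant_weights (c : 'I_K -> R) : (forall j, 0 < c j) -> \sum_(j < K) c j = 1 ->
  random_weights Q (fun j _ => c j).
Proof.
move=> c0 c1; split=> //; first by move=> j v; exact: ltW.
exists 1; split=> // j; rewrite /neg_power gt_eqF// integral_cst//.
apply: lte_mul_pinfty => //; first by rewrite lee_fin powR_ge0.
by apply: le_lt_trans (probability_le1 Q measurableT) _; rewrite ltry.
Qed.

(** Finitely many null events cannot cover a probability space. *)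
Lemma some_positive_event (E : 'I_K -> set V) : (forall v, exists j, E j v) ->
  (forall j, measurable (E j)) -> exists j, (0 < Q (E j))%E.
Proof.
move=> hE mE; apply/not_existsP => Q0.
have z j : {ae Q, forall v, ~ E j v}.
  exists (E j); split=> //; last by move=> v /= /contrapT.
  by apply/eqP; rewrite eq_le measure_ge0 andbT leNgt; apply/negP; exact: Q0.
have : {ae Q, forall v, forall j, ~ E j v} by exact: filter_forall.
move=> [N [mN N0 hN]]; have := probability_setT Q.
have -> : setT = N by apply/seteqP; split=> // v _; apply: hN => /= h; have [j /h] := hE v.
by rewrite N0 => /eqP; rewrite eqe eq_sym oner_eq0.
Qed.

End Weights.

(** * Almost sure bounds on the dimensions *)

Section AlmostSure.
Context {R : realType} d1 d2 (U : measurableType d1) (V : measurableType d2)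
  (P : probability U R) (Q : probability V R).
Context (PP : probability (sequence_space (U * V)%type) R)
  (hPP : is_infinite_power (P \x Q)%E PP).

(** Elements of the sequence space are used as plain functions, and the instance
    search does not see through that identification. *)
#[global] Instance ae_sequence_filter : Filter (nbhs (almost_everywhere PP)).
Proof. exact: ae_filter_ringOfSetsType. Qed.

Lemma coordinate_ae (N : set (U * V)) : measurable N -> (P \x Q)%E N = 0%E ->
  {ae PP, forall w, forall k : nat, ~ N (w k)}.
Proof.
move=> mN N0; apply/ae_foralln => k.
exists [set w | N (w k)]; split; first exact: coordinate_measurable.
  exact: etrans (coordinate_prob hPP k mN (base_setT hPP)) N0.
by move=> w /= /contrapT.
Qed.

Lemma coordinate_ae1 (E : U -> Prop) : {ae P, forall u, E u} ->
  {ae PP, forall w, forall k : nat, E (w k).1}.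
Proof.
move=> [N [mN N0 hN]].
have PN : (P \x Q)%E (N `*` setT) = (P N * Q setT)%E by exact: product_measure1E.
have := @coordinate_ae (N `*` setT) (measurableX mN measurableT).
rewrite PN N0 mul0e => /(_ erefl).
apply: filterS => w hw k; apply: contrapT => nE; apply: (hw k); split=> //.
exact: hN.
Qed.

Lemma coordinate_ae2 (E : V -> Prop) : {ae Q, forall v, E v} ->
  {ae PP, forall w, forall k : nat, E (w k).2}.
Proof.
move=> [N [mN N0 hN]].
have QN : (P \x Q)%E (setT `*` N) = (P setT * Q N)%E by exact: product_measure1E.
have := @coordinate_ae (setT `*` N) (measurableX measurableT mN).
rewrite QN N0 mule0 => /(_ erefl).
apply: filterS => w hw k; apply: contrapT => nE; apply: (hw k); split=> //.
exact: hN.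
Qed.

Context (K : nat) (A B tau : R) (S : 'I_K -> U -> R -> R) (a : 'I_K -> U -> R)
  (hIFS : random_ifs A B tau S a) (p : 'I_K -> V -> R) (hp : random_weights Q p).
Context (mu : (nat -> U * V) -> probability (measurableTypeR R) R)
  (hmu : forall w, is_random_measure (fun j z => S j z.1) (fun j z => p j z.2) w (mu w)).

Implicit Types w : nat -> U * V.

Notation q w := (fun k j => p j (w k).2).
Notation u w := (fun k => (w k).1).
Notation asup j := (fine (ess_sup P (EFin \o a j))).
Notation ainf j := (fine (ess_inf P (EFin \o a j))).

Lemma random_measure_cyl w c n : mu w (cyl S (u w) c n) = (mass (q w) c n)%:E.
Proof.
have [_ h] := hmu w; have := h n [tuple c k | k < n].
rewrite (_ : cylinder _ _ _ = cyl S (u w) c n); last first.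
  rewrite /cylinder /cyl /branch; congr (_ @` _).
  by apply: eq_bigr => k _; rewrite tnth_mktuple.
by move=> ->; congr EFin; apply: eq_bigr => k _; rewrite tnth_mktuple.
Qed.

Lemma path_weight_ge0 w k j : 0 <= q w k j. Proof. exact: (weights_ge0 hp). Qed.
Lemma path_weight_sum1 w k : \sum_(j < K) q w k j = 1. Proof. exact: (weights_sum1 hp). Qed.

Lemma asup_bounds j : 0 < asup j < 1.
Proof.
have [_ /andP[h1 h2]] := ess_supr_bounds P (ifs_factor_ge hIFS j) (factor_le hIFS j).
by rewrite (lt_le_trans (ifs_A_gt0 hIFS) h1) (le_lt_trans h2 (ifs_B_lt1 hIFS)).
Qed.

Lemma ainf_bounds j : 0 < ainf j < 1.
Proof.
have [_ /andP[h1 h2]] := ess_infr_bounds P (ifs_factor_ge hIFS j) (factor_le hIFS j).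
by rewrite (lt_le_trans (ifs_A_gt0 hIFS) h1) (le_lt_trans h2 (ifs_B_lt1 hIFS)).
Qed.

(** For [e < D] pick [e'] strictly between. Then [asup j ^ D] is
    [asup j ^ (D - e')], which is less than 1, times [alpha ^ e] for an [alpha]
    still below [asup j]. By independence, [a j > alpha] and
    [p j <= asup j ^ D] hold together with positive probability, and long runs of
    this event exclude [e]. *)
Lemma upper_dim_ge_ae j (D : R) : 0 < D -> (0 < Q [set v | (p j v <= asup j `^ D)%R])%E ->
  {ae PP, forall w, forall Phi, small_dimension_function Phi ->
     (D%:E <= upper_Phi_dim Phi (mu w))%E}.
Proof.
move=> D0 hQ; have /andP[s0 s1] := asup_bounds j.
have aeq := coordinate_ae2 (weights_gt0_ae hp j).
have main n : {ae PP, forall w, forall Phi, small_dimension_function Phi ->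
    ~ upper_exponent Phi (mu w) (D * (1 - n.+2%:R^-1))}.
  pose e := D * (1 - n.+2%:R^-1); pose e' := (e + D) / 2.
  have n20 : 0 < (n.+2%:R^-1 : R) by rewrite invr_gt0 ltr0n.
  have n21 : (n.+2%:R^-1 : R) < 1 by rewrite invf_lt1 ?ltr0n// ltr1n.
  have e0 : 0 < e by rewrite mulr_gt0// subr_gt0.
  have eD : e < D by rewrite /e gtr_pMr// ltrBlDr ltrDl.
  pose alpha := asup j `^ (e' / e).
  have alphae : alpha `^ e = asup j `^ e' by rewrite -powRrM divfK// gt_eqF.
  have alphas : alpha < asup j.
    rewrite -[ltRHS]powRr1 ?(ltW s0)//; apply: powR_lt_exp; rewrite ?s0//.
    by rewrite ltr_pdivlMr// mul1r /e'; lra.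
  pose theta := asup j `^ (D - e').
  have theta0 : 0 < theta by rewrite powR_gt0.
  have theta1 : theta < 1.
    by rewrite -[ltRHS](powRr0 (asup j)); apply: powR_lt_exp; rewrite ?s0// /e'; lra.
  have thetaE : asup j `^ D = theta * alpha `^ e.
    by rewrite alphae /theta -powRD ?subrK//; rewrite gt_eqF ?implybT.
  pose G := [set u | alpha < a j u] `*` [set v | p j v <= asup j `^ D].
  have mG1 : measurable [set u | alpha < a j u].
    exact: measurable_gt (ifs_factor_measurable hIFS j) _.
  have mG2 : measurable [set v | p j v <= asup j `^ D].
    exact: measurable_le (weights_measurable hp j) _.
  have G0 : (0 < (P \x Q) G)%E.
    rewrite /G product_measure1E// mule_gt0//.
    exact: (near_ess_sup_prob (ifs_factor_ge hIFS j) (factor_le hIFS j) (ifs_factor_measurable hIFS j) alphas).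
  have [b hb] := long_runs hPP (measurableX mG1 mG2) G0.
  apply: filterS2 hb aeq => w hw qw Phi sPhi.
  apply: (low_mass_run_upper hIFS (path_weight_ge0 w) (path_weight_sum1 w) (random_measure_cyl w) qw sPhi theta0 theta1 (b := b)).
  move=> M; have [m [Mm [k [kb run]]]] := hw M; exists m; split=> //; exists k; split=> // i ik.
  have [/= h1 h2] := run i ik; apply: le_trans h2 _; rewrite thetaE ler_pM2l//.
  by apply: ge0_ler_powR; rewrite ?nnegrE ?(ltW h1) ?(ltW e0) ?powR_ge0// ltW// (factor_gt0 hIFS).
have /ae_foralln := main; apply: filterS => w h Phi sPhi.
by apply: upper_dim_ge => // n; exact: h.
Qed.

(** Symmetric to the upper case, with [alpha] slightly above [ainf j] and a
    factor [ainf j ^ (D - e')] greater than 1. *)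
Lemma lower_dim_le_ae j (D : R) : 0 < D -> (0 < Q [set v | (ainf j `^ D <= p j v)%R])%E ->
  {ae PP, forall w, forall Phi, small_dimension_function Phi ->
     (lower_Phi_dim Phi (mu w) <= D%:E)%E}.
Proof.
move=> D0 hQ; have /andP[s0 s1] := ainf_bounds j.
have aeq := coordinate_ae2 (weights_gt0_ae hp j).
have main n : {ae PP, forall w, forall Phi, small_dimension_function Phi ->
    ~ lower_exponent Phi (mu w) (D * (1 + n.+1%:R^-1))}.
  pose e := D * (1 + n.+1%:R^-1); pose e' := (e + D) / 2.
  have n2 : 0 < (n.+1%:R^-1 : R) by rewrite invr_gt0 ltr0n.
  have e0 : 0 < e by rewrite mulr_gt0// addr_gt0.
  have eD : D < e by rewrite /e ltr_pMr// ltrDl.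
  pose alpha := ainf j `^ (e' / e).
  have alphae : alpha `^ e = ainf j `^ e' by rewrite -powRrM divfK// gt_eqF.
  have alphas : ainf j < alpha.
    rewrite -[ltLHS]powRr1 ?(ltW s0)//; apply: powR_lt_exp; rewrite ?s0//.
    by rewrite ltr_pdivrMr// mul1r /e'; lra.
  pose kappa := ainf j `^ (D - e').
  have kappa1 : 1 < kappa.
    by rewrite -[ltLHS](powRr0 (ainf j)); apply: powR_lt_exp; rewrite ?s0// /e'; lra.
  have kappaE : ainf j `^ D = kappa * alpha `^ e.
    by rewrite alphae /kappa -powRD ?subrK//; rewrite gt_eqF ?implybT.
  pose G := [set u | a j u < alpha] `*` [set v | ainf j `^ D <= p j v].
  have mG1 : measurable [set u | a j u < alpha].
    exact: measurable_lt (ifs_factor_measurable hIFS j) _.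
  have mG2 : measurable [set v | ainf j `^ D <= p j v].
    exact: measurable_ge (weights_measurable hp j) _.
  have G0 : (0 < (P \x Q) G)%E.
    rewrite /G product_measure1E// mule_gt0//.
    exact: (near_ess_inf_prob (ifs_factor_ge hIFS j) (factor_le hIFS j) (ifs_factor_measurable hIFS j) alphas).
  have [b hb] := long_runs hPP (measurableX mG1 mG2) G0.
  apply: filterS2 hb aeq => w hw qw Phi sPhi.
  apply: (high_mass_run_lower hIFS (path_weight_ge0 w) (path_weight_sum1 w) (random_measure_cyl w) qw sPhi kappa1 (b := b)).
  move=> M; have [m [Mm [k [kb run]]]] := hw M; exists m; split=> //; exists k; split=> // i ik.
  have [/= h1 h2] := run i ik; apply: le_trans h2; rewrite kappaE ler_pM2l ?(lt_trans _ kappa1)//.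
  by apply: ge0_ler_powR; rewrite ?nnegrE ?(ltW h1) ?(ltW e0) ?powR_ge0// ltW// (factor_gt0 hIFS).
have /ae_foralln := main; apply: filterS => w h Phi sPhi.
by apply: lower_dim_le => // n; exact: h.
Qed.

Lemma upper_dim_le_ae (D : R) : 0 <= D -> (forall j v, asup j `^ D <= p j v) ->
  {ae PP, forall w, forall Phi, (upper_Phi_dim Phi (mu w) <= D%:E)%E}.
Proof.
move=> D0 h.
have : {ae P, forall v, forall j, a j v <= asup j}.
  apply: filter_forall => j.
  exact: le_ess_supr_ae (ifs_factor_ge hIFS j) (factor_le hIFS j).
move/coordinate_ae1; apply: filterS => w hw Phi; apply: upper_dim_le.
apply: (upper_exponent_uniform hIFS (path_weight_ge0 w) (path_weight_sum1 w) (random_measure_cyl w) Phi D0) => k j.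
apply: le_trans (h j _).
apply: (ge0_ler_powR D0 _ _ (hw k j)); rewrite nnegrE; first exact: ltW (factor_gt0 hIFS _ _).
by have /andP[/ltW] := asup_bounds j.
Qed.

Lemma lower_dim_ge_ae (D : R) : 0 <= D -> (forall j v, p j v <= ainf j `^ D) ->
  {ae PP, forall w, forall Phi, (D%:E <= lower_Phi_dim Phi (mu w))%E}.
Proof.
move=> D0 h.
have : {ae P, forall v, forall j, ainf j <= a j v}.
  apply: filter_forall => j.
  exact: ge_ess_infr_ae (ifs_factor_ge hIFS j) (factor_le hIFS j).
move/coordinate_ae1; apply: filterS => w hw Phi; apply: lower_dim_ge.
apply: (lower_exponent_uniform hIFS (path_weight_ge0 w) (path_weight_sum1 w) (random_measure_cyl w) Phi D0) => k j.
apply: le_trans (h j _) _.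
apply: (ge0_ler_powR D0 _ _ (hw k j)); rewrite nnegrE; last exact: ltW (factor_gt0 hIFS _ _).
by have /andP[/ltW] := ainf_bounds j.
Qed.
End AlmostSure.

(** * Weights realizing a prescribed dimension *)

Section MoranWeights.
Context {R : realType} (K : nat) (x : 'I_K -> R).
Context (K2 : (2 <= K)%N) (x01 : forall j, 0 < x j < 1).
Implicit Types (s t : R).

Let K0 : (0 < K)%N. Proof. exact: leq_trans K2. Qed.
Let i0 : 'I_K := Ordinal K0.
Let i1 : 'I_K := Ordinal K2.

Lemma moran_gt0 s : \sum_(j < K) x j `^ s = 1 -> 0 < s.
Proof.
move=> sum1; rewrite ltNge; apply/negP => s0.
have : (K%:R : R) <= 1.
  apply: (@le_trans _ _ (\sum_(j < K) x j `^ s)); last by rewrite sum1.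
  have -> : K%:R = \sum_(j < K) (1 : R) by rewrite big_const_ord iter_addr_0.
  apply: ler_sum => j _; have /andP[x0 x1] := x01 j.
  by rewrite -(powRr0 (x j)); apply: ger_powR; rewrite ?x0 ?(ltW x1).
by rewrite lern1 leqNgt K2.
Qed.

Lemma powR_decr s t j : s <= t -> x j `^ t <= x j `^ s.
Proof. by have /andP[x0 x1] := x01 j => st; apply: ger_powR; rewrite ?x0 ?(ltW x1). Qed.

Lemma exists_le_of_sum (f g : 'I_K -> R) :
  \sum_(j < K) f j <= \sum_(j < K) g j -> exists j, f j <= g j.
Proof.
move=> fg; apply/not_existsP => h; move: fg; rewrite leNgt => /negP; apply.
apply: ltr_sum => [|j _]; last by rewrite ltNge; apply/negP.
by apply/hasP; exists i0; rewrite ?mem_index_enum.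
Qed.

(** The powers [x j ^ D] sum to at most 1; the missing mass is given to one letter
    and another letter keeps equality. *)
Lemma weights_above_powers Delta D : \sum_(j < K) x j `^ Delta = 1 -> Delta <= D ->
  exists c : 'I_K -> R, [/\ forall j, 0 < c j, \sum_(j < K) c j = 1,
    forall j, x j `^ D <= c j & exists j, c j <= x j `^ D].
Proof.
move=> sum1 dD; pose z := 1 - \sum_(j < K) x j `^ D.
have z0 : 0 <= z.
  by rewrite subr_ge0 -sum1; apply: ler_sum => j _; exact: powR_decr.
pose c j := x j `^ D + z *+ (j == i1).
have cx j : x j `^ D <= c j by rewrite /c lerDl mulrn_wge0.
exists c; split=> //; last by exists i0; rewrite /c mulr0n addr0.
  move=> j; apply: lt_le_trans (cx j); rewrite powR_gt0//.
  by have /andP[] := x01 j.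
rewrite big_split/= [X in _ + X](bigD1 i1)//= [X in _ + (_ + X)]big1 => [|j /negPf ->//].
by rewrite addr0 /z addrC subrK.
Qed.

(** One letter keeps equality and the other powers, whose sum is at least the
    mass left over, are scaled down. *)
Lemma weights_below_powers delta r : \sum_(j < K) x j `^ delta = 1 ->
  0 < r -> r <= delta ->
  exists c : 'I_K -> R, [/\ forall j, 0 < c j, \sum_(j < K) c j = 1,
    forall j, c j <= x j `^ r & exists j, x j `^ r <= c j].
Proof.
move=> sum1 r0 rd; pose y j := x j `^ r.
have y0 j : 0 < y j by rewrite powR_gt0//; have /andP[] := x01 j.
have y1 : y i0 < 1.
  have /andP[p0 p1] := x01 i0.
  by rewrite /y /powR gt_eqF// -[ltRHS]expR0 ltr_expR pmulr_rlt0// ln_lt0// p0.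
pose T := \sum_(j < K | j != i0) y j.
have T0 : 0 < T.
  rewrite /T (bigD1 i1)//= ltr_pwDl// sumr_ge0// => j _; exact: ltW.
have sumy : 1 <= y i0 + T.
  rewrite /T -(bigD1 i0 (P := xpredT))//= -sum1; apply: ler_sum => j _; exact: powR_decr.
pose s := (1 - y i0) / T.
have s0 : 0 < s by rewrite divr_gt0// subr_gt0.
have s1 : s <= 1 by rewrite ler_pdivrMr// mul1r; lra.
exists (fun j => if j == i0 then y i0 else s * y j); split.
- by move=> j; case: ifP => // _; rewrite mulr_gt0.
- rewrite (bigD1 i0)//= (eq_bigr (fun j => s * y j)) => [|j /negPf ->//].
  by rewrite -mulr_sumr -/T /s divfK ?gt_eqF// addrC subrK.
- move=> j; case: eqP => [->//|_]; by rewrite ler_piMl// ltW.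
- by exists i0; rewrite eqxx.
Qed.

End MoranWeights.

Theorem theorem9 (R : realType) (d1 : measure_display) (U : measurableType d1)
    (P : probability U R) (K : nat) (A B tau : R)
    (S : 'I_K -> U -> R -> R) (a : 'I_K -> U -> R)
    (hIFS : random_ifs A B tau S a) :
  (forall Delta : R, 0 <= Delta ->
     \sum_(j < K) fine (ess_sup P (EFin \o a j)) `^ Delta = 1 ->
     (forall (d2 : measure_display) (V : measurableType d2)
        (Q : probability V R) (p : 'I_K -> V -> R),
        random_weights Q p ->
        almost_surely P Q S p (fun mu => forall Phi : R -> R,
          small_dimension_function Phi ->
          (Delta%:E <= upper_Phi_dim Phi mu)%E)) /\
     (forall D : R, Delta <= D ->
        exists (d2 : measure_display) (V : measurableType d2)
          (Q : probability V R) (p : 'I_K -> V -> R),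
          random_weights Q p /\
          almost_surely P Q S p (fun mu => forall Phi : R -> R,
            small_dimension_function Phi ->
            upper_Phi_dim Phi mu = D%:E))) /\
  (forall delta : R,
     \sum_(j < K) fine (ess_inf P (EFin \o a j)) `^ delta = 1 ->
     (forall (d2 : measure_display) (V : measurableType d2)
        (Q : probability V R) (p : 'I_K -> V -> R),
        random_weights Q p ->
        almost_surely P Q S p (fun mu => forall Phi : R -> R,
          small_dimension_function Phi ->
          (lower_Phi_dim Phi mu <= delta%:E)%E)) /\
     (forall r : R, 0 < r -> r <= delta ->
        exists (d2 : measure_display) (V : measurableType d2)
          (Q : probability V R) (p : 'I_K -> V -> R),
          random_weights Q p /\
          almost_surely P Q S p (fun mu => forall Phi : R -> R,
            small_dimension_function Phi ->
            lower_Phi_dim Phi mu = r%:E))).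
Proof.
have K2 := ifs_K_ge2 hIFS.
split=> [Delta _ sum1|delta sum1].
  have D0 := moran_gt0 K2 (asup_bounds P hIFS) sum1.
  split=> [d2 V Q p hp PP hPP mu hmu|D DD].
    have le_sum v : \sum_(j < K) p j v <=
        \sum_(j < K) fine (ess_sup P (EFin \o a j)) `^ Delta.
      by rewrite sum1 (weights_sum1 hp).
    have [j Qj] := @some_positive_event _ _ _ Q K
      (fun j => [set v | p j v <= fine (ess_sup P (EFin \o a j)) `^ Delta])
      (fun v => exists_le_of_sum K2 (le_sum v))
      (fun j => measurable_le (weights_measurable hp j) _).
    exact: (upper_dim_ge_ae hPP hIFS hp hmu D0 Qj).
  have [c [c0 c1 cge [j cj]]] := weights_above_powers K2 (asup_bounds P hIFS) sum1 DD.
  exists d1, U, P, (fun j _ => c j); have hp := constant_weights P c0 c1.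
  split=> // PP hPP mu hmu.
  have Dp : 0 < D by exact: lt_le_trans DD.
  have Qj : (0 < P [set v | (c j <= fine (ess_sup P (EFin \o a j)) `^ D)%R])%E.
    rewrite (_ : [set v | _] = setT) ?probability_setT//.
    by apply/seteqP; split.
  have h1 := upper_dim_ge_ae hPP hIFS hp hmu Dp Qj.
  have h2 := upper_dim_le_ae hPP hIFS hp hmu (ltW Dp) (fun j _ => cge j).
  move: h1 h2; apply: filterS2 => w h1 h2 Phi sPhi.
  by apply/eqP; rewrite eq_le h2 h1.
have D0 := moran_gt0 K2 (ainf_bounds P hIFS) sum1.
split=> [d2 V Q p hp PP hPP mu hmu|r r0 rd].
  have ge_sum v : \sum_(j < K) fine (ess_inf P (EFin \o a j)) `^ delta <=
      \sum_(j < K) p j v.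
    by rewrite sum1 (weights_sum1 hp).
  have [j Qj] := @some_positive_event _ _ _ Q K
    (fun j => [set v | fine (ess_inf P (EFin \o a j)) `^ delta <= p j v])
    (fun v => exists_le_of_sum K2 (ge_sum v))
    (fun j => measurable_ge (weights_measurable hp j) _).
  exact: (lower_dim_le_ae hPP hIFS hp hmu D0 Qj).
have [c [c0 c1 cle [j cj]]] := weights_below_powers K2 (ainf_bounds P hIFS) sum1 r0 rd.
exists d1, U, P, (fun j _ => c j); have hp := constant_weights P c0 c1.
split=> // PP hPP mu hmu.
have Qj : (0 < P [set v | (fine (ess_inf P (EFin \o a j)) `^ r <= c j)%R])%E.
  rewrite (_ : [set v | _] = setT) ?probability_setT//.
  by apply/seteqP; split.
have h1 := lower_dim_le_ae hPP hIFS hp hmu r0 Qj.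
have h2 := lower_dim_ge_ae hPP hIFS hp hmu (ltW r0) (fun j _ => cle j).
move: h1 h2; apply: filterS2 => w h1 h2 Phi sPhi.
by apply/eqP; rewrite eq_le h2 h1.
Qed.
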